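(* Let $g\colon F_2\to F_2$ be a monomorphism and let $G=F_2\ast_g$ be the associated descending HNN extension. Then the Bieri–Neumann–Strebel invariant $\Sigma(G)$ has finitely many connected components.
   Context: For a monomorphism $g\colon F_2\to F_2$ of the free group of rank two, $F_2\ast_g=\langle F_2,t\mid t^{-1}xt=g(x)\ (x\in F_2)\rangle$. For a group $G$ with finite generating set $\mathcal S$, $S(G)=(\mathrm{Hom}(G,\mathbb{R})\smallsetminus\{0\})/\mathbb{R}_{>0}$ with the quotient topology (homeomorphic to a sphere), and $\Sigma(G)\subseteq S(G)$ is the set of $[\phi]\in S(G)$ for which the full subgraph of the Cayley graph $\mathrm{Cay}(G,\mathcal S)$ on the vertices $\{h\in G\mid\phi(h)\ge0\}$ is connected; it carries the subspace topology. *)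

(* Defs.v *)
From HB Require Import structures.
From mathcomp Require Import all_boot all_order all_algebra.
From mathcomp Require Import all_classical all_reals all_analysis.
From Stdlib Require Import Relation_Operators.
Import Order.TTheory GRing.Theory Num.Theory.
Import numFieldNormedType.Exports.

Set Implicit Arguments.
Unset Strict Implicit.
Unset Printing Implicit Defensive.

Local Open Scope classical_set_scope.
Local Open Scope ring_scope.
Local Open Scope quotient_scope.

(* The letter (x, true) stands for x and (x, false) for its inverse. *)
Definition word (X : Type) : Type := seq (X * bool).

Definition letter (X : Type) (x : X) : word X := [:: (x, true)].
Definition inv_word (X : Type) (w : word X) : word X :=
  rev [seq (l.1, ~~ l.2) | l <- w].

Section Presentation.
Context (X : choiceType) (rels : word X -> word X -> Prop).

Inductive pres_eq : word X -> word X -> Prop :=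
| pres_refl u : pres_eq u u
| pres_sym u v : pres_eq u v -> pres_eq v u
| pres_trans u v w : pres_eq u v -> pres_eq v w -> pres_eq u w
| pres_cat u u' v v' :
    pres_eq u u' -> pres_eq v v' -> pres_eq (u ++ v) (u' ++ v')
| pres_cancel x b : pres_eq [:: (x, b); (x, ~~ b)] [::]
| pres_rel u v : rels u v -> pres_eq u v.

Definition pres_eqb (u v : seq (X * bool)) : bool := `[< pres_eq u v >].

Lemma pres_eqb_equiv : equiv_class_of pres_eqb.
Proof.
split=> [u|u v|v u w].
- exact/asboolP/pres_refl.
- by apply/asboolP/asboolP; exact: pres_sym.
- by move=> /asboolP uv /asboolP vw; apply/asboolP/(pres_trans uv vw).
Qed.

Canonical pres_equiv := EquivRelPack pres_eqb_equiv.

(* The group < X | u = v for all (u, v) such that rels u v >. *)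
Definition presented_group : Type := {eq_quot pres_equiv}.

HB.instance Definition _ := Choice.on presented_group.

Definition pres_class (w : word X) : presented_group :=
  \pi_({eq_quot pres_equiv}) w.
Definition pres_repr (a : presented_group) : word X :=
  repr (a : {eq_quot pres_equiv}).

Lemma pres_reprK a : pres_class (pres_repr a) = a.
Proof. exact: reprK. Qed.

Lemma pres_classP u v : pres_class u = pres_class v <-> pres_eq u v.
Proof. by split=> [/eqmodP/asboolP|uv]; last exact/eqmodP/asboolP. Qed.

Lemma pres_repr_class w : pres_eq (pres_repr (pres_class w)) w.
Proof. by apply/pres_classP; rewrite pres_reprK. Qed.

Definition pres_one : presented_group := pres_class [::].
Definition pres_mul (a b : presented_group) : presented_group :=
  pres_class (pres_repr a ++ pres_repr b).
Definition pres_inv (a : presented_group) : presented_group :=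
  pres_class (inv_word (pres_repr a)).

Lemma pres_mulE u v :
  pres_mul (pres_class u) (pres_class v) = pres_class (u ++ v).
Proof. by apply/pres_classP/pres_cat; exact: pres_repr_class. Qed.

Lemma pres_mulA : associative pres_mul.
Proof.
move=> a b c; rewrite -(pres_reprK a) -(pres_reprK b) -(pres_reprK c).
by rewrite !pres_mulE catA.
Qed.

Lemma pres_mul1g : left_id pres_one pres_mul.
Proof. by move=> a; rewrite -(pres_reprK a) pres_mulE. Qed.

Lemma pres_mulg1 : right_id pres_one pres_mul.
Proof. by move=> a; rewrite -(pres_reprK a) pres_mulE cats0. Qed.

Lemma pres_eq_mulV (w : word X) : pres_eq (w ++ inv_word w) [::].
Proof.
elim: w => [|[x b] w IH]; first exact: pres_refl.
rewrite /inv_word /= rev_cons -cats1.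
apply: (pres_trans _ (pres_cancel x b)).
rewrite catA; apply: (@pres_cat [:: (x, b)] _ _ [:: (x, ~~ b)] (pres_refl _)).
exact: (@pres_cat _ [::] _ _ IH (pres_refl _)).
Qed.

Lemma inv_wordK : involutive (@inv_word X).
Proof.
move=> w; rewrite /inv_word map_rev revK -map_comp map_id_in // => -[x b] _.
by rewrite /= negbK.
Qed.

Lemma pres_mulgV : right_inverse pres_one pres_inv pres_mul.
Proof.
move=> a; rewrite -{1}(pres_reprK a) pres_mulE.
exact/pres_classP/pres_eq_mulV.
Qed.

Lemma pres_mulVg : left_inverse pres_one pres_inv pres_mul.
Proof.
move=> a; rewrite -{2}(pres_reprK a) pres_mulE; apply/pres_classP.
by rewrite -{2}[pres_repr a]inv_wordK; exact: pres_eq_mulV.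
Qed.

HB.instance Definition _ := isGroup.Build presented_group
  pres_mulA pres_mul1g pres_mulg1 pres_mulVg pres_mulgV.

End Presentation.

Definition free_group (X : choiceType) : groupType :=
  @presented_group X (fun _ _ => False).

Definition F2 : groupType := free_group 'I_2.

(* The generators are the elements Some x of A and the stable letter t = None;
   hnn_mul is the multiplication table of A, so hnn g is
   < A, t | t^-1 x t = g(x) for all x in A >. *)
Inductive hnn_rels (A : groupType) (g : A -> A) :
    word (option A) -> word (option A) -> Prop :=
| hnn_mul x y :
    hnn_rels g (letter (Some x) ++ letter (Some y)) (letter (Some (x * y)%g))
| hnn_conj x :
    hnn_rels g (inv_word (letter None) ++ letter (Some x) ++ letter None)
               (letter (Some (g x))).

Definition hnn (A : groupType) (g : A -> A) : groupType :=
  presented_group (hnn_rels g).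

Section CharacterSphere.
Context (R : realType) (G : groupType).

(* Hom(G, R) minus 0, in the topology of pointwise convergence; when G is
   finitely generated this is the topology of the finite-dimensional real
   vector space Hom(G, R). *)
Definition nonzero_characters : set {ptws G -> R} :=
  [set phi | (forall x y : G, phi (x * y)%g = phi x + phi y) /\
             exists x : G, phi x != 0].

Definition character := set_type nonzero_characters.
HB.instance Definition _ := Topological.on character.

Definition char_fun (phi : character) : G -> R := set_val phi.

Definition ray_eqb (phi psi : character) : bool :=
  `[< exists2 c : R, 0 < c & forall x, char_fun psi x = c * char_fun phi x >].

Lemma ray_eqb_equiv : equiv_class_of ray_eqb.
Proof.
have sym phi psi : ray_eqb phi psi -> ray_eqb psi phi.
  move=> /asboolP[c c0 e]; apply/asboolP; exists c^-1; rewrite ?invr_gt0//.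
  by move=> x; rewrite e mulKf// gt_eqF.
split=> [phi|phi psi|psi phi chi].
- by apply/asboolP; exists 1 => // x; rewrite mul1r.
- by apply/idP/idP; exact: sym.
- move=> /asboolP[c c0 e] /asboolP[d d0 f]; apply/asboolP.
  by exists (d * c); [exact: mulr_gt0|move=> x; rewrite f e mulrA].
Qed.

Canonical ray_equiv := EquivRelPack ray_eqb_equiv.

Definition character_sphere : Type :=
  quotient_topology {eq_quot ray_equiv}.
HB.instance Definition _ := Topological.on character_sphere.

Definition ray (phi : character) : character_sphere :=
  \pi_(quotient_topology {eq_quot ray_equiv}) phi.

End CharacterSphere.

Definition generates (G : groupType) (S : set G) : Prop :=
  forall H : set G,
    H 1%g -> (forall x y, H x -> H y -> H (x * y)%g) ->
    (forall x, H x -> H x^-1%g) -> S `<=` H -> H = [set: G].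

Definition cayley_adj (G : groupType) (S : set G) (h k : G) : Prop :=
  exists2 s, S s & k = (h * s)%g \/ h = (k * s)%g.

Definition full_subgraph_connected (V : Type) (adj : V -> V -> Prop)
    (U : set V) : Prop :=
  forall h k, U h -> U k ->
    clos_refl_trans V (fun x y => [/\ U x, U y & adj x y]) h k.

Definition BNS (R : realType) (G : groupType) (S : set G) :
    set (character_sphere R G) :=
  [set ray phi | phi in [set phi : character R G |
     full_subgraph_connected (cayley_adj S) [set h | 0 <= char_fun phi h]]].

Arguments BNS R [G] S.

Definition connected_components (T : topologicalType) (A : set T) :
    set (set T) :=
  [set connected_component A x | x in A].

(* Main.v *)
Require Import Defs.
From HB Require Import structures.
From mathcomp Require Import all_boot all_order all_algebra.
From mathcomp Require Import all_classical all_reals all_analysis.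
From mathcomp Require Import zify ring lra.
From Stdlib Require Import Relation_Operators.

(** Let [F] be free on [a, b] and let [t] be the stable letter of [G]. A
    character [phi] lies in Sigma iff every function [f : G -> bool] whose
    differences [f (h x) + f h] all vanish for [phi h] large is constant for
    [phi h] large, that is iff [H^1(G; M) = 0], where [M] consists of the
    functions [G -> F_2] vanishing where [phi] is large. If [phi c > 0] for a
    basis [d, c] of [F], such an [f] can be normalised to be [c]-invariant;
    Fox calculus then identifies [H^1(G; M)] with the kernel on [M] of one
    Novikov series [t^-1 + A + (1 + g d) * \sum_n (g c)^n * B], where [A, B] are
    the Fox derivatives of [g d, g c] with respect to [d].

    Whether this kernel vanishes only depends on the [phi]-minimal part [w] of
    the series, a finite sum of elements of [F] and possibly [t^-1]: a function
    annihilated by [w] extends downwards to an element of the kernel because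
    [w] acts surjectively on all functions on [G]. The surjectivity follows from
    the inequality [max (|x k|, |x k^-1|) > |x|] ([k != 1]) for word length in
    [F]. On characters, the support of the series lies on finitely many rays
    [y + N c], so only finitely many [w] occur, each on a convex set of
    characters. Letting [c] run over [a, a^-1, b, b^-1] and adding the two rays
    of characters trivial on [F], finitely many convex sets cover all
    characters and membership in Sigma is constant on each of them. *)

Set Implicit Arguments.
Unset Strict Implicit.
Unset Printing Implicit Defensive.
Import Order.TTheory GRing.Theory Num.Theory.
Import numFieldNormedType.Exports.

(** * Presented groups and word length in free groups *)

Section WordAction.
Context (X : choiceType) (rels : word X -> word X -> Prop).
Context (E : Type) (step : E -> X * bool -> E).

(** Maps out of a presented group are obtained from actions of letters on states. The invariant [P]
    is there because opposite letters may undo each other only on good states, such as reduced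
    stacks. *)
Lemma pres_eq_foldl (P : E -> Prop) :
  (forall s l, P s -> P (step s l)) ->
  (forall s x b, P s -> step (step s (x, b)) (x, ~~ b) = s) ->
  (forall u v, rels u v -> forall s, P s -> foldl step s u = foldl step s v) ->
  forall u v, pres_eq rels u v ->
  forall s, P s -> foldl step s u = foldl step s v.
Proof.
move=> Pstep stepK stepR.
have Pfold u s : P s -> P (foldl step s u).
  by elim: u s => //= l u IH s Ps; apply/IH/Pstep.
move=> u v; elim=> {u v} [||u v w _ IH1 _ IH2|u u' v v' _ IH1 _ IH2|x b|u v].
- by [].
- by move=> u v _ IH s Ps; rewrite IH.
- by move=> s Ps; rewrite IH1// IH2.
- by move=> s Ps; rewrite !foldl_cat IH1// IH2//; exact: Pfold.
- by move=> s Ps /=; rewrite stepK.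
- by move=> uv s Ps; exact: stepR.
Qed.

End WordAction.

Section PresentedGroup.
Context (X : choiceType) (rels : word X -> word X -> Prop).
Local Notation G := (presented_group rels).

Lemma pres_classM u v :
  pres_class rels (u ++ v) = (pres_class rels u * pres_class rels v)%g.
Proof. by rewrite -pres_mulE. Qed.

Lemma pres_class_nil : pres_class rels [::] = 1%g.
Proof. by []. Qed.

Lemma pres_class_negb x b :
  pres_class rels [:: (x, ~~ b)] = (pres_class rels [:: (x, b)])^-1%g.
Proof.
apply/esym/mulg1_eq; rewrite -pres_classM -pres_class_nil.
by apply/pres_classP; exact: pres_cancel.
Qed.

Lemma pres_class_ind (H : G -> Prop) :
  H 1%g -> (forall x y, H x -> H y -> H (x * y)%g) ->
  (forall x, H x -> H x^-1%g) ->
  (forall x, H (pres_class rels (letter x))) -> forall a, H a.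
Proof.
move=> H1 HM HV Hx a; rewrite -(pres_reprK a).
elim: (pres_repr a) => // -[x b] w IH.
rewrite -cat1s pres_classM; apply: HM => //.
by case: b; [exact: Hx|rewrite -[false]/(~~ true) pres_class_negb; exact/HV/Hx].
Qed.

End PresentedGroup.

Section FreeGroupLength.
Context (X : choiceType).
Local Notation F := (free_group X).
Local Notation cls := (@pres_class X (fun _ _ => False)).
Implicit Types (l : X * bool) (s w : word X).

Definition flip l : X * bool := (l.1, ~~ l.2).

Lemma flipK : involutive flip.
Proof. by case=> x b; rewrite /flip /= negbK. Qed.

Lemma flip_neq l : flip l != l.
Proof. by case: l => x b; rewrite /flip xpair_eqE eqxx; case: b. Qed.

(* A stack is a reduced word read backwards. *)
Definition push s l : word X :=
  if s is l' :: s' then if l' == flip l then s' else l :: s else [:: l].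

Definition reduced s := sorted (fun l l' => l' != flip l) s.

Lemma reduced_push s l : reduced s -> reduced (push s l).
Proof.
case: s => //= l' s; case: eqP => [_|/eqP ll'] /=; first exact: path_sorted.
by rewrite ll'.
Qed.

Lemma pushK s l : reduced s -> push (push s l) (flip l) = s.
Proof.
case: s => [|l' s] /=; first by rewrite flipK eqxx.
case: eqP => [->|_] /=; last by rewrite flipK eqxx.
by case: s => //= l2 s /andP[/negPf->].
Qed.

Definition nf w := foldl push [::] w.

Lemma reduced_nf w : reduced (nf w).
Proof.
rewrite /nf; have : reduced [::] by [].
by elim: w [::] => //= l w IH s rs; apply/IH/reduced_push.
Qed.

Lemma pres_eq_foldl_push u v s : reduced s ->
  pres_eq (fun _ _ => False) u v -> foldl push s u = foldl push s v.
Proof.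
move=> rs uv; apply: (pres_eq_foldl (P := reduced) _ _ _ uv) => // [s' l|s' x b].
  exact: reduced_push.
exact: pushK.
Qed.

Lemma cls_foldl_push s w :
  cls (rev (foldl push s w)) = (cls (rev s) * cls w)%g.
Proof.
elim: w s => [|l w IH] s /=; first by rewrite pres_class_nil mulg1.
rewrite IH -cat1s pres_classM mulgA; congr (_ * _)%g.
case: s => [|l' s] /=; first by rewrite pres_class_nil mul1g.
case: eqP => [->|_]; last by rewrite rev_cons -cats1 pres_classM.
rewrite rev_cons -cats1 pres_classM -mulgA.
by case: l => x b; rewrite [X in (_ * (X * _))%g]pres_class_negb mulVg mulg1.
Qed.

Lemma cls_nf w : cls (rev (nf w)) = cls w.
Proof. by rewrite cls_foldl_push mul1g. Qed.

Definition flen (x : F) : nat := size (nf (pres_repr x)).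

Lemma flenE w : flen (cls w) = size (nf w).
Proof.
by congr size; apply: pres_eq_foldl_push => //; exact: pres_repr_class.
Qed.

Lemma size_foldl_push l s w : path (fun l l' => l' != flip l) l w ->
  size (foldl push (l :: s) w) = (size s + size w).+1.
Proof.
elim: w l s => [|l' w IH] l s /=; first by rewrite addn0.
case/andP=> ll' pw; case: eqP => [e|_]; last by rewrite IH//= addSnnS.
by rewrite e flipK eqxx in ll'.
Qed.

(** Since [w] is reduced, no letter cancels after the first one that does not; [i] counts the
    cancelled letters. *)
Lemma foldl_push_cancel w s l0 : reduced w -> exists i,
  [/\ i <= size w, size (foldl push s w) + i.*2 = size s + size w &
      forall j, j < i -> nth l0 s j = flip (nth l0 w j)].
Proof.
elim: w s => [|l w IH] s rw; first by exists 0; rewrite !addn0.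
case: s => [|l' s] /=.
  by exists 0; rewrite size_foldl_push//= !addn0 add0n.
case: eqP => [->|_].
  have [i [iw Ei Hi]] := IH s (path_sorted rw).
  exists i.+1; split=> //; first by rewrite doubleS !addnS Ei addSn.
  by case=> [|j] //= /Hi.
by exists 0; rewrite size_foldl_push//= addn0 addnS.
Qed.

Lemma reduced_rev w : reduced (rev w) = reduced w.
Proof.
rewrite /reduced rev_sorted; apply: eq_sorted => l l' /=.
by rewrite -(inj_eq (can_inj flipK)) flipK eq_sym.
Qed.

Lemma reduced_inv_word w : reduced (inv_word w) = reduced w.
Proof.
rewrite /inv_word reduced_rev /reduced sorted_map; apply: eq_sorted => l l' /=.
by rewrite -[(l'.1, _)]/(flip l') -[(l.1, _)]/(flip l) (inj_eq (can_inj flipK)).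
Qed.

Lemma cls_inv_word w : cls (inv_word w) = (cls w)^-1%g.
Proof.
apply/esym/mulg1_eq; rewrite -pres_classM -pres_class_nil.
apply/pres_classP; exact: pres_eq_mulV.
Qed.

(* If neither product were longer, more than half of [k] would be cancelled
   on both sides, so the letters of [k] around its middle would be inverse to
   each other. *)
Lemma flen_mul_gt (c k : F) : k != 1%g ->
  (flen c < flen (c * k)%g) || (flen c < flen (c * k^-1)%g).
Proof.
rewrite -(pres_reprK c) -(pres_reprK k) -(cls_nf (pres_repr k)).
have := reduced_nf (pres_repr k); rewrite -reduced_rev.
move: (rev _) (pres_repr c) => {c}w c rw wN1.
rewrite -cls_inv_word -!pres_classM !flenE /nf !foldl_cat -/(nf c).
move: (nf c) => s; rewrite [X in X || _]ltnNge [X in _ || X]ltnNge -negb_and.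
apply/negP => /andP[sw swV].
case: w => [|l0 w'] in rw wN1 sw swV *; first by rewrite eqxx in wN1.
set w := l0 :: w' in rw sw swV.
have [i [iw Ei Hi]] := foldl_push_cancel s l0 rw.
have [|j [jw Ej Hj]] := @foldl_push_cancel (inv_word w) s l0.
  by rewrite reduced_inv_word.
have szV : size (inv_word w) = size w by rewrite size_rev size_map.
rewrite szV in jw Ej Hj.
have w0 : 0 < size w by [].
(* Both cancellations cover at least half of [w], hence index [m]. So letter [m] is inverse to
   letter [size w - m.+1], which is the same letter when the size is odd and its right neighbour
   when it is even. *)
pose m := (size w).-1./2.
have mi : m < i by rewrite /m; lia.
have mj : m < j by rewrite /m; lia.
have := Hi _ mi; rewrite (Hj _ mj) /inv_word -map_rev.
rewrite (nth_map l0) ?size_rev; last by lia.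
rewrite nth_rev; last by lia.
rewrite -/(flip _) => /(can_inj flipK).
have [odd_w|even_w] := boolP (odd (size w)).
  rewrite (_ : size w - m.+1 = m); last by rewrite /m; lia.
  by move/eqP; rewrite (negPf (flip_neq _)).
rewrite (_ : size w - m.+1 = m.+1); last by rewrite /m; lia.
have /(sortedP l0)/(_ m) := rw; rewrite (_ : m.+1 < size w); last by rewrite /m; lia.
by move/(_ isT) => /negP + e; rewrite -e flipK eqxx; apply.
Qed.


End FreeGroupLength.

(** * Fox derivatives and descending HNN extensions *)

Section GroupMorphism.
Context (G H : groupType) (f : {multiplicative G -> H}).

Lemma group_morph1 : f 1%g = 1%g.
Proof. by apply: (mulgI (f 1%g)); rewrite -gmulfM !mulg1. Qed.

Lemma group_morphV : {morph f : x / x^-1%g}.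
Proof. by move=> x; apply/esym/mulg1_eq; rewrite -gmulfM mulgV group_morph1. Qed.

Lemma group_morphX n : {morph f : x / (x ^+ n)%g}.
Proof.
by elim: n => [|n IH] x; rewrite ?expg0 ?group_morph1// !expgS gmulfM IH.
Qed.

End GroupMorphism.

Section RightAction.
Context (G : groupType).
Implicit Types (l : seq G) (f : G -> bool) (h y : G).

(* The right action of the mod 2 group ring element [\sum_(x <- l) x] on
   functions. *)
Definition wsum l f h : bool := \big[addb/false]_(x <- l) f (h * x)%g.

Lemma wsum_nil f h : wsum [::] f h = false.
Proof. exact: big_nil. Qed.

Lemma wsum_cons x l f h : wsum (x :: l) f h = f (h * x)%g (+) wsum l f h.
Proof. exact: big_cons. Qed.

Lemma wsum_cat l1 l2 f h : wsum (l1 ++ l2) f h = wsum l1 f h (+) wsum l2 f h.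
Proof. exact: big_cat. Qed.

Lemma wsum_mul y l f h : wsum [seq (y * x)%g | x <- l] f h = wsum l f (h * y)%g.
Proof. by rewrite /wsum big_map; apply: eq_bigr => x _; rewrite mulgA. Qed.

Lemma wsum_add l f1 f2 h :
  wsum l (fun z => f1 z (+) f2 z) h = wsum l f1 h (+) wsum l f2 h.
Proof. exact: big_split. Qed.

Lemma eq_wsum l f1 f2 h :
  (forall x, x \in l -> f1 (h * x)%g = f2 (h * x)%g) ->
  wsum l f1 h = wsum l f2 h.
Proof. by move=> e; apply: eq_big_seq. Qed.

Lemma wsum0 l f h : (forall x, x \in l -> f (h * x)%g = false) ->
  wsum l f h = false.
Proof. by move=> e; rewrite /wsum big_seq big1. Qed.

End RightAction.

Section FoxDerivative.
Context (X : choiceType) (G : groupType) (j : X).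
Local Notation F := (free_group X).
Local Notation cls := (@pres_class X (fun _ _ => False)).

Definition fgen (x : X) : F := cls (letter x).

(** Signs disappear mod 2, so an inverse letter contributes itself. Only the action of the list
    through [wsum], not the list, is independent of the chosen word. *)
Fixpoint fox_word (w : word X) : seq F :=
  if w is l :: w' then
    (if l.1 == j then [:: if l.2 then 1%g else cls [:: l]] else [::]) ++
    [seq (cls [:: l] * x)%g | x <- fox_word w']
  else [::].

Definition fox (x : F) : seq F := fox_word (pres_repr x).

Context (iota : {multiplicative F -> G}) (f : G -> bool).

(** A word moves the point of [G], while the bit accumulates the Fox derivative applied to [f].
    Opposite letters undo each other, which makes this action of the derivative well defined on
    [F]. *)
Let step (s : G * bool) (l : X * bool) : G * bool :=
  ((s.1 * iota (cls [:: l]))%g,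
   s.2 (+) ((l.1 == j) && f (if l.2 then s.1 else s.1 * iota (cls [:: l]))%g)).

Let foldl_step w s : foldl step s w =
  ((s.1 * iota (cls w))%g, s.2 (+) wsum [seq iota x | x <- fox_word w] f s.1).
Proof.
elim: w s => [|l w IH] [h e] /=.
  by rewrite wsum_nil addbF pres_class_nil group_morph1 mulg1.
rewrite IH /= -[in cls (l :: w)]cat1s pres_classM gmulfM mulgA; congr (_, _).
rewrite map_cat wsum_cat -addbA; congr (_ (+) (_ (+) _)).
  case: (l.1 == j) => /=; last by rewrite wsum_nil.
  rewrite wsum_cons wsum_nil addbF.
  by case: l.2 => //; rewrite group_morph1 mulg1.
rewrite -wsum_mul -!map_comp; congr wsum.
by apply: eq_map => x /=; rewrite gmulfM.
Qed.

Let wsum_fox_word u v h : pres_eq (fun _ _ => False) u v ->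
  wsum [seq iota x | x <- fox_word u] f h =
  wsum [seq iota x | x <- fox_word v] f h.
Proof.
move=> uv.
suff : foldl step (h, false) u = foldl step (h, false) v.
  by rewrite !foldl_step => -[_ /= ->].
apply: (pres_eq_foldl (P := fun=> True) _ _ _ uv) => // -[h' e] x b _.
rewrite /step /= pres_class_negb group_morphV mulgK; congr (_, _).
by case: b => /=; rewrite -addbA addbb addbF.
Qed.

Lemma wsum_foxM x y h : wsum [seq iota z | z <- fox (x * y)%g] f h =
  wsum [seq iota z | z <- fox x] f h (+)
  wsum [seq iota z | z <- fox y] f (h * iota x)%g.
Proof.
have xy : pres_eq (fun _ _ => False)
    (pres_repr (x * y)%g) (pres_repr x ++ pres_repr y).
  by apply/pres_classP; rewrite pres_classM !pres_reprK.
rewrite /fox (wsum_fox_word _ xy).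
have := foldl_step (pres_repr x ++ pres_repr y) (h, false).
rewrite foldl_cat !foldl_step /= pres_reprK => -[_].
by move=> <-.
Qed.

Lemma wsum_fox_gen i h :
  wsum [seq iota z | z <- fox (fgen i)] f h = (i == j) && f h.
Proof.
rewrite /fox (@wsum_fox_word _ (letter i)); last exact: pres_repr_class.
rewrite /= cats0; case: (i == j) => /=; last exact: wsum_nil.
by rewrite wsum_cons wsum_nil addbF group_morph1 mulg1.
Qed.

Lemma wsum_fox1 h : wsum [seq iota z | z <- fox 1%g] f h = false.
Proof.
rewrite /fox (@wsum_fox_word _ [::]); first exact: wsum_nil.
by apply/pres_classP; rewrite pres_reprK.
Qed.

Lemma wsum_foxV x h : wsum [seq iota z | z <- fox x^-1%g] f h =
  wsum [seq iota z | z <- fox x] f (h * iota x^-1)%g.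
Proof.
by have := wsum_fox1 h; rewrite -(mulVg x) wsum_foxM; do 2 case: (wsum _ _ _).
Qed.

End FoxDerivative.

Section HNN.
Context (A : groupType) (g : A -> A).
Local Notation G := (hnn g).
Local Notation cls := (pres_class (hnn_rels g)).

Definition hnn_base (x : A) : G := cls (letter (Some x)).
Definition hnn_stable : G := cls (letter None).
Local Notation t := hnn_stable.

Lemma hnn_baseM : {morph hnn_base : x y / (x * y)%g}.
Proof.
move=> x y; rewrite /hnn_base -pres_classM; apply/pres_classP/pres_sym.
by apply: pres_rel; exact: hnn_mul.
Qed.

HB.instance Definition _ := isMultiplicative.Build A G hnn_base hnn_baseM.

Lemma hnn_base_conj x : (hnn_base x * t = t * hnn_base (g x))%g.
Proof.
apply: (mulgI t^-1%g); rewrite mulKg /hnn_stable /hnn_base.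
rewrite -[X in (X * _)%g](pres_class_negb (hnn_rels g) None true).
rewrite -(pres_classM _ (letter (Some x)) (letter None)) -pres_classM.
apply/pres_classP/pres_rel; exact: hnn_conj.
Qed.

Lemma hnn_ind (H : G -> Prop) :
  (forall x y, H x -> H y -> H (x * y)%g) ->
  (forall x, H x -> H x^-1%g) ->
  (forall x, H (hnn_base x)) -> H t -> forall a, H a.
Proof.
move=> HM HV Hb Ht; apply: pres_class_ind => //; last by case.
by rewrite -(group_morph1 hnn_base).
Qed.

(** This is the exponent sum of [t], which agrees on both sides of every relation. *)
Lemma hnn_exp_subproof : exists e : G -> int,
  [/\ {morph e : x y / (x * y)%g >-> (x + y)%R}, forall x, e (hnn_base x) = 0%R
    & e t = 1%R].
Proof.
pose step (z : int) (l : option A * bool) : int :=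
  if l.1 is None then (if l.2 then z + 1 else z - 1)%R else z.
pose e (a : G) : int := foldl step 0%R (pres_repr a).
have inv u v z : pres_eq (hnn_rels g) u v -> foldl step z u = foldl step z v.
  move=> uv; apply: (pres_eq_foldl (P := fun=> True) _ _ _ uv) => //.
    by move=> {}z [x|] [] _; rewrite /step /=; lia.
  by move=> _ _ [x y|x] {}z _; rewrite /step /=; lia.
have shift w z : foldl step z w = (z + foldl step 0 w)%R.
  elim: w z => [|[[x|] b] w IH] z /=; first by rewrite GRing.addr0.
    by rewrite IH.
  by rewrite IH [in RHS]IH /step /=; case: b; lia.
exists e; split=> [x y|x|].
- rewrite /e (inv _ (pres_repr x ++ pres_repr y)); last first.
    by apply/pres_classP; rewrite pres_classM !pres_reprK.
  by rewrite foldl_cat shift.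
- by rewrite /e (inv _ (letter (Some x)))//; exact: pres_repr_class.
- by rewrite /e (inv _ (letter None))//; exact: pres_repr_class.
Qed.

Definition hnn_exp : G -> int := sval (cid hnn_exp_subproof).

Lemma hnn_expM : {morph hnn_exp : x y / (x * y)%g >-> (x + y)%R}.
Proof. by rewrite /hnn_exp; case: cid => e []. Qed.

Lemma hnn_exp_base x : hnn_exp (hnn_base x) = 0%R.
Proof. by rewrite /hnn_exp; case: cid => e []. Qed.

Lemma hnn_exp_stable : hnn_exp t = 1%R.
Proof. by rewrite /hnn_exp; case: cid => e []. Qed.

(* [f] is the second coordinate of the translates of [(1, false)] under the
   action of G on [G * bool] in which generators act on the fibre through [d]
   and [s]. *)
Lemma hnn_cocycle (d : A -> G -> bool) (s : G -> bool) :
  (forall x y h, d (x * y)%g h = d x h (+) d y (h * hnn_base x)%g) ->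
  (forall x h, s h (+) d x (h * t^-1)%g (+) s (h * hnn_base (g x))%g =
               d (g x) h) ->
  exists f : G -> bool,
    (forall x h, f (h * hnn_base x)%g (+) f h = d x h) /\
    (forall h, f (h * t)%g (+) f h = s (h * t)%g).
Proof.
move=> dM ds.
(* The increment of [f] along the edge from [h] labelled [l]. The value [s] is attached to the
   endpoint of a [t]-edge, and an inverse letter reads the edge it traverses backwards. *)
pose dl (l : option A * bool) h : bool := match l with
  | (Some x, true) => d x h | (Some x, false) => d x (h * hnn_base x^-1)%g
  | (None, true) => s (h * t)%g | (None, false) => s h end.
pose step (p : G * bool) l := ((p.1 * cls [:: l])%g, p.2 (+) dl l p.1).
have clsV x : cls [:: (x, false)] = (cls (letter x))^-1%g.
  exact: (pres_class_negb _ x true).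
have inv u v p : pres_eq (hnn_rels g) u v -> foldl step p u = foldl step p v.
  move=> uv; apply: (pres_eq_foldl (P := fun=> True) _ _ _ uv) => // {p}.
    move=> [h e] x b _; rewrite /step /= pres_class_negb mulgK; congr (_, _).
    rewrite -addbA -[RHS]addbF; congr (_ (+) _); case: x b => [x|] [] /=.
    - by rewrite group_morphV mulgK addbb.
    - by rewrite clsV group_morphV addbb.
    - by rewrite addbb.
    - by rewrite clsV mulgVK addbb.
  move=> _ _ [x y|x] [h e] _; rewrite /step /=.
    rewrite -mulgA -[cls [:: (Some (x * y)%g, true)]]/(hnn_base (x * y)%g).
    by rewrite hnn_baseM dM addbA.
  rewrite clsV -/t; congr (_, _).
    rewrite -!mulgA -[cls [:: (Some x, _)]]/(hnn_base x) hnn_base_conj.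
    by rewrite mulKg.
  rewrite -ds -[cls [:: (Some x, _)]]/(hnn_base x).
  by rewrite -!mulgA hnn_base_conj mulKg !addbA.
have step1 w p : (foldl step p w).1 = (p.1 * cls w)%g.
  elim: w p => [|l w IH] p /=; first by rewrite pres_class_nil mulg1.
  by rewrite IH -cat1s pres_classM mulgA.
pose f (h : G) := (foldl step (1%g, false) (pres_repr h)).2.
have fM h l : f (h * cls [:: l])%g = f h (+) dl l h.
  rewrite /f (inv _ (pres_repr h ++ [:: l])); last first.
    by apply/pres_classP; rewrite pres_classM !pres_reprK.
  by rewrite foldl_cat /= step1 mul1g pres_reprK.
exists f; split=> [x h|h].
  by rewrite (fM h (Some x, true)) addbC addbA addbb.
by rewrite (fM h (None, true)) addbC addbA addbb.
Qed.

End HNN.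

Section HNNEmbedding.
Context (A : groupType) (g : {multiplicative A -> A}).
Local Notation G := (hnn g).

(* The state [(x, n)] stands for [x * t^-n]. Elements are only multiplied
   correctly as long as the exponent [n] does not become negative, so relations
   are checked for large [n]. *)
Let step (s : A * nat) (l : option A * bool) : A * nat := match l with
  | (Some y, b) => ((s.1 * iter s.2 g (if b then y else y^-1))%g, s.2)
  | (None, b) => (s.1, if b then s.2.-1 else s.2.+1) end.

Let foldl_step2 w s : s.2 <= (foldl step s w).2 + size w.
Proof.
elim: w s => [|l w IH] s /=; first by rewrite addn0.
by have := IH (step s l); case: l => -[y|] [] /=; lia.
Qed.

Let iterM n : {morph iter n g : x y / (x * y)%g}.
Proof. by elim: n => [|n IH] x y //; rewrite !iterS IH gmulfM. Qed.

Let iter1 n : iter n g 1%g = 1%g.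
Proof. by elim: n => //= n ->; rewrite group_morph1. Qed.

Let foldl_step_eq u v : pres_eq (hnn_rels g) u v ->
  exists n0, forall n x, n0 <= n -> foldl step (x, n) u = foldl step (x, n) v.
Proof.
elim=> {u v} [u|u v _ [n0 IH]|u v w _ [n1 IH1] _ [n2 IH2]
  |u u' v v' _ [n1 IH1] _ [n2 IH2]|x b|u v].
- by exists 0.
- by exists n0 => n x nn; rewrite IH.
- by exists (maxn n1 n2) => n x; rewrite geq_max => /andP[/IH1-> /IH2->].
(* Reading [u] lowers the exponent by at most [size u], so [v] still starts above its own threshold
   [n2]. *)
- exists (n1 + n2 + size u) => n x nn; rewrite !foldl_cat -IH1; last by lia.
  have := foldl_step2 u (x, n); case: (foldl step (x, n) u) => y m /= nm.
  apply: IH2; rewrite -(leq_add2r (size u)); apply: leq_trans nm.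
  by apply: leq_trans nn; rewrite leq_add2r leq_addl.
- exists 1 => n y n1; case: x => [x|] /=; last by case: b => //=; congr (_, _); lia.
  congr (_, _); rewrite -mulgA -iterM.
  by case: b; rewrite /= ?mulgV ?mulVg iter1 mulg1.
- case=> [x y|x]; exists 0 => n z _ /=; first by rewrite iterM mulgA.
  by rewrite -iterSr.
Qed.

(** Equal elements act alike on the state [(1, n0)] for some large [n0], which gives
    [iter n0 g x = iter n0 g y]. *)
Lemma hnn_base_inj : injective g -> injective (@hnn_base A g).
Proof.
move=> g_inj x y /pres_classP/foldl_step_eq[n0 /(_ n0 1%g (leqnn n0))].
rewrite /= !mul1g => -[].
by elim: n0 => //= n IH /g_inj.
Qed.

End HNNEmbedding.

(** * Surjectivity of group ring elements on functions *)

Section Surjectivity.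
Context (G : groupType) (d : Order.disp_t) (T : orderType d) (rk : G -> T).
Context (w : seq G).
Hypothesis wf_lt : well_founded (fun x y : T => (x < y)%O).
Hypothesis w_uniq : uniq w.
Hypothesis w_neq0 : w != [::].
Hypothesis rk_gt : forall h h' x x', x \in w -> x' \in w -> h != h' ->
  (h * x = h' * x')%g ->
  (rk (h * x)%g < rk (h * x')%g)%O || (rk (h * x)%g < rk (h' * x)%g)%O.

Let pivot_subproof h :
  exists2 x, x \in w & forall y, y \in w -> (rk (h * y)%g <= rk (h * x)%g)%O.
Proof.
elim: w w_neq0 => // x [|y w'] IH _.
  by exists x; rewrite ?mem_head// => y; rewrite inE => /eqP->.
have [//|z zw zmax] := IH.
have [xz|zx] := leP (rk (h * x)%g) (rk (h * z)%g).
  by exists z => [|v]; rewrite in_cons ?zw ?orbT// => /predU1P[->//|/zmax].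
exists x => [|v]; rewrite ?mem_head// in_cons => /predU1P[->//|/zmax vz].
exact: le_trans vz (ltW zx).
Qed.

Let px h := s2val (cid2 (pivot_subproof h)).
Let pivot h := (h * px h)%g.

Let pxw h : px h \in w. Proof. by rewrite /px; case: cid2. Qed.

Let pivot_max h y : y \in w -> (rk (h * y)%g <= rk (pivot h))%O.
Proof. by rewrite /pivot /px; case: cid2 => x /= _; apply. Qed.

(** By [rk_gt], an unknown common to two equations is exceeded in rank within one of them. If it is
    the pivot of [h'], this has to happen in the equation at [h]. *)
Let pivot_lt h h' x : x \in w -> h != h' -> (h * x)%g = pivot h' ->
  (rk (h * x)%g < rk (pivot h))%O.
Proof.
move=> xw hh' e.
have [|] := orP (rk_gt xw (pxw h') hh' e).
  by move/lt_le_trans; apply; exact: pivot_max.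
by rewrite e ltNge pivot_max.
Qed.

Let pivot_inj : injective pivot.
Proof.
move=> h h' e; apply/eqP/negPn/negP => hh'.
by have := pivot_lt (pxw h) hh' e; rewrite ltxx.
Qed.

(* The equation [wsum w a h = c h] is solved for the value of [a] at
   [pivot h]; the other pivots among the [h * x] have smaller rank. *)
Lemma wsum_surj (c : G -> bool) : exists a, forall h, wsum w a h = c h.
Proof.
pose R (z z' : G) := (rk z < rk z')%O.
have wfR : well_founded R.
  move=> z; have := wf_lt (rk z).
  move e : (rk z) => r acc; elim: acc z e => {}r _ IH z e.
  by constructor=> z' z'z; apply: IH (erefl _); rewrite -e.
(* Values off the pivots are free and set to [false]. Terms failing the rank test are dropped: by
   [pivot_lt] they are not pivots, so the solution vanishes there. *)
pose F z (rec : forall z', R z' z -> bool) : bool :=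
  match pselect (exists h, z = pivot h) with
  | left pz => let h := sval (cid pz) in
    c h (+) \big[addb/false]_(x <- w | x != px h)
       (if pselect (R (h * x)%g z) is left xz then rec (h * x)%g xz else false)
  | right _ => false
  end.
pose a := Fix wfR (fun=> bool) F.
have aE z : a z = F z (fun z' _ => a z').
  apply: Fix_eq => {}z f f' ff'; rewrite /F; case: pselect => // pz.
  congr (_ (+) _); apply: eq_bigr => x _; case: pselect => //.
exists a => h; rewrite /wsum (bigD1_seq (px h))//= -/(pivot h) aE /F.
case: pselect => [pz|]; last by case; exists h.
have -> /= : sval (cid pz) = h by case: (cid pz) => h' /= /pivot_inj.
rewrite -addbA -[RHS]addbF; congr (_ (+) _).
rewrite -big_split big_seq_cond big1// => x /andP[xw xN] /=.
case: pselect => [_|nR]; first exact: addbb.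
rewrite addFb aE /F; case: pselect => // -[h' e]; case: nR.
apply: (pivot_lt xw _ e); apply: contra xN => /eqP hh'.
by rewrite -hh' in e; move/mulgI: e => ->.
Qed.

End Surjectivity.

Lemma ltlexi_nat (x y : nat *l nat) :
  (x < y)%O = (x.1 < y.1) || (x.1 == y.1) && (x.2 < y.2).
Proof.
rewrite ltEprodlexi /= !leEnat ltEnat.
by case: ltngtP.
Qed.
Lemma wf_lexi_nat : well_founded (fun x y : nat *l nat => (x < y)%O).
Proof.
suff H m n : Acc (fun x y : nat *l nat => (x < y)%O) (m, n) by case.
elim/ltn_ind: m n => m IHm; elim/ltn_ind => n IHn.
constructor=> -[m' n']; rewrite ltlexi_nat /= => /orP[/IHm//|].
by case/andP=> /eqP-> /IHn.
Qed.

Section HNNSurjectivity.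
Context (X : choiceType) (g : {multiplicative free_group X -> free_group X}).
Hypothesis g_inj : injective g.
Local Notation F := (free_group X).
Local Notation G := (hnn g).
Local Notation iota := (@hnn_base F g).
Local Notation t := (hnn_stable g).
Local Open Scope classical_set_scope.

(** Choosing a representative of each left coset of the base gives every [z] a coordinate [fpart z]
    in [F], which right multiplication by the base multiplies on the right. Word length is measured
    on this coordinate. *)
Let coset (z : G) : set G := [set z' | exists x, z' = (z * iota x)%g].
Let rep (z : G) : G := xget 1%g (coset z).
Let fpart (z : G) : F := xget 1%g [set x | z = (rep z * iota x)%g].

Let rep_mul z k : rep (z * iota k)%g = rep z.
Proof.
rewrite /rep (_ : coset (z * iota k)%g = coset z)//.
apply/seteqP; split=> z' [x ->]; first by exists (k * x)%g; rewrite gmulfM mulgA.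
by exists (k^-1 * x)%g; rewrite -mulgA -gmulfM mulVKg.
Qed.

Let fpartE z : z = (rep z * iota (fpart z))%g.
Proof.
have : coset z (rep z).
  by apply: xgetPex; exists z, 1%g; rewrite group_morph1 mulg1.
move=> [x zx]; have zx' : z = (rep z * iota x^-1)%g.
  by rewrite zx group_morphV mulgK.
exact: (@xgetPex _ 1%g [set y | z = (rep z * iota y)%g]) (ex_intro _ _ zx').
Qed.

Let fpart_mul z k : fpart (z * iota k)%g = (fpart z * k)%g.
Proof.
apply: (hnn_base_inj g_inj); apply: (mulgI (rep z)).
by rewrite -{1}(rep_mul z k) -fpartE gmulfM mulgA -fpartE.
Qed.

Let rk (z : G) : nat *l nat := (absz (hnn_exp z), flen (fpart z)).

(** If [h t^-1 = h' y] has exponent [n], then [h y] and [h' t^-1] have exponents [n + 1] and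
    [n - 1], one of which exceeds [n] in absolute value. When both factors lie in the base, the
    exponents agree and [flen_mul_gt] compares the lengths. *)
Lemma hnn_wsum_surj (w : seq G) : uniq w -> w != [::] ->
  (forall x, x \in w -> x = t^-1%g \/ exists y, x = iota y) ->
  forall c : G -> bool, exists a, forall h, wsum w a h = c h.
Proof.
move=> w_uniq w_neq0 wP.
apply: (wsum_surj (rk := rk) wf_lexi_nat w_uniq w_neq0).
have expV : hnn_exp t^-1%g = (-1)%R.
  have := hnn_expM t t^-1%g; rewrite mulgV hnn_exp_stable.
  by rewrite -(group_morph1 iota) hnn_exp_base; lia.
move=> h h' x x' /wP xP /wP x'P hh' e; rewrite /rk !ltlexi_nat /=.
have ee := congr1 (@hnn_exp F g) e; rewrite !hnn_expM in ee *.
move: xP x'P e ee => [->|[y ->]] [->|[y' ->]] e; rewrite ?expV ?hnn_exp_base => ee.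
- by rewrite (mulIg _ _ _ e) eqxx in hh'.
- move: (hnn_exp h) (hnn_exp h') ee => a a' ee.
  have /orP[->|->] : (absz (a + -1)%R < absz (a + 0)%R) ||
                 (absz (a + -1)%R < absz (a' + -1)%R) by lia.
    by [].
  by rewrite orbT.
- move: (hnn_exp h) (hnn_exp h') ee => a a' ee.
  have /orP[->|->] : (absz (a + 0)%R < absz (a + -1)%R) ||
                 (absz (a + 0)%R < absz (a' + 0)%R) by lia.
    by [].
  by rewrite orbT.
have eh' : h' = (h * iota (y * y'^-1))%g.
  by rewrite gmulfM group_morphV mulgA e mulgK.
rewrite eh' hnn_expM hnn_exp_base !addr0 eqxx ltnn /= !fpart_mul.
rewrite (_ : fpart h * y' = fpart h * y * (y^-1 * y'))%g; last first.
  by rewrite -!mulgA mulVKg.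
rewrite (_ : fpart h * (y * y'^-1) * y = fpart h * y * (y^-1 * y')^-1)%g; last first.
  by rewrite invgM invgK !mulgA.
apply: flen_mul_gt; apply: contraNneq hh' => yy'; rewrite eh' => {eh'}.
by rewrite -(mulg1_eq yy') invgK mulgV group_morph1 mulg1.
Qed.

End HNNSurjectivity.

(** * Characters and the cohomological criterion *)

Lemma seq_ubound (R : realType) (T : eqType) (s : seq T) (c : T -> R) :
  exists C, forall x, x \in s -> (c x <= C)%R.
Proof.
elim: s => [|x s [C HC]]; first by exists 0%R.
exists (Num.max (c x) C) => y; rewrite inE le_max => /predU1P[->|/HC->].
  by rewrite lexx.
by rewrite orbT.
Qed.

Lemma addb_eqF a b : a (+) b = false -> a = b.
Proof. by case: a b => -[]. Qed.

Lemma exists_natr_ge (R : realType) (x : R) : exists n, (x <= n%:R)%R.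
Proof.
exists (Num.bound `|x|%R); apply/ltW/(le_lt_trans (ler_norm _)).
exact: archi_boundP (normr_ge0 _).
Qed.

Section Characters.
Context (R : realType) (G : groupType) (phi : G -> R).
Hypothesis phiM : forall x y, phi (x * y)%g = (phi x + phi y)%R.
Local Open Scope classical_set_scope.
Local Open Scope ring_scope.

Lemma character1 : phi 1%g = 0.
Proof. by apply: (addrI (phi 1%g)); rewrite -phiM mulg1 addr0. Qed.

Lemma characterV x : phi x^-1%g = - phi x.
Proof. by apply: (addrI (phi x)); rewrite -phiM mulgV subrr character1. Qed.

Lemma characterX x n : phi (x ^+ n)%g = phi x *+ n.
Proof. by elim: n => [|n IH]; rewrite ?expg0 ?character1// expgS phiM IH mulrS. Qed.

Definition vanishes_above (f : G -> bool) :=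
  exists C, forall h, C <= phi h -> f h = false.

Lemma vanishes_above_shift f x : vanishes_above f ->
  vanishes_above (fun h => f (h * x)%g).
Proof.
by move=> [C HC]; exists (C - phi x) => h hC; apply: HC; rewrite phiM; lra.
Qed.

Lemma vanishes_above_add f1 f2 : vanishes_above f1 -> vanishes_above f2 ->
  vanishes_above (fun h => f1 h (+) f2 h).
Proof.
move=> [C1 H1] [C2 H2]; exists (Num.max C1 C2) => h.
by rewrite ge_max => /andP[/H1-> /H2->].
Qed.

Lemma eq_vanishes_above f1 f2 : f1 =1 f2 ->
  vanishes_above f1 -> vanishes_above f2.
Proof. by move=> f12 [C HC]; exists C => h /HC; rewrite f12. Qed.

Definition delta (f : G -> bool) (x h : G) : bool := f (h * x)%g (+) f h.

Lemma vanishes_above_deltaM f x y : vanishes_above (delta f x) ->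
  vanishes_above (delta f y) -> vanishes_above (delta f (x * y)%g).
Proof.
move=> Hx Hy; apply: eq_vanishes_above; last first.
  exact: vanishes_above_add (vanishes_above_shift x Hy) Hx.
by move=> h; rewrite /delta mulgA -addbA (addbA (f (h * x)%g)) addbb addFb.
Qed.

Lemma vanishes_above_deltaV f x : vanishes_above (delta f x) ->
  vanishes_above (delta f x^-1%g).
Proof.
move=> Hx; apply: eq_vanishes_above; last exact: vanishes_above_shift x^-1%g Hx.
by move=> h; rewrite /delta mulgVK addbC.
Qed.

Lemma phi_unbounded x C : phi x != 0 -> exists y, C <= phi y.
Proof.
wlog x0 : x / 0 < phi x => [IH xN0|_].
  have [x0|x0] := ltP 0 (phi x); first exact: IH x0 xN0.
  apply: (IH x^-1%g); rewrite characterV ?oppr_eq0// oppr_gt0.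
  by rewrite lt_neqAle xN0.
have [n Cn] := exists_natr_ge (C / phi x).
by exists (x ^+ n)%g; rewrite characterX -mulr_natl -ler_pdivrMr.
Qed.

Let clos_sym (S U : set G) h k :
  clos_refl_trans G (fun x y => [/\ U x, U y & cayley_adj S x y]) h k ->
  clos_refl_trans G (fun x y => [/\ U x, U y & cayley_adj S x y]) k h.
Proof.
elim=> {h k} [h k [Uh Uk [s Ss hk]]|h|h k l _ kh _ lk]; last 2 first.
- exact: rt_refl.
- exact: rt_trans lk kh.
by apply: rt_step; split=> //; exists s => //; rewrite orC.
Qed.

Definition eventually_constant_criterion :=
  forall f, (forall x, vanishes_above (delta f x)) ->
    exists C e, forall h, C <= phi h -> f h = e.

(** At high levels [f] does not change along the finitely many generators, so connectedness of a
    translated half-space makes it constant there. Conversely, the indicator of a component of the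
    half-space is unchanged along each generator at high levels, and any two vertices climb inside
    the half-space to where it is constant. *)
Lemma connected_nonnegP (S : set G) : finite_set S -> generates S ->
  (exists x, phi x != 0) ->
  full_subgraph_connected (cayley_adj S) [set h | 0 <= phi h] <->
  eventually_constant_criterion.
Proof.
move=> S_fin S_gen [x0 phix0]; set U := [set h | 0 <= phi h].
split=> [conn f Hf|H h0 k0 Uh0 Uk0].
  have [c Hc] := choice Hf.
  have /finite_seqP[s Ss] := S_fin.
  have [C HC] := seq_ubound s c.
  have [y Cy] := phi_unbounded C phix0.
  have inv h k : clos_refl_trans G
      (fun x y => [/\ U x, U y & cayley_adj S x y]) h k ->
      f (y * h)%g = f (y * k)%g.
    elim=> {h k} [h k [Uh Uk [z Sz hk]]|//|h k l _ -> _ -> //].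
    have inv1 x : U x -> f (y * (x * z))%g = f (y * x)%g.
      move=> Ux; rewrite mulgA; apply/addb_eqF/(Hc z).
      apply: le_trans (le_trans (HC z _) Cy) _; first by rewrite Ss in Sz.
      by rewrite phiM lerDl.
    by case: hk => ->; rewrite inv1.
  exists (phi y), (f y) => h yh.
  have /inv : clos_refl_trans G (fun x y => [/\ U x, U y & cayley_adj S x y])
     1%g (y^-1 * h)%g by apply: conn; rewrite /U /= ?character1// phiM characterV; lra.
  by rewrite mulg1 mulVKg.
set adj := fun x y => [/\ U x, U y & cayley_adj S x y].
pose f h := `[< clos_refl_trans G adj h0 h >].
have Hf x : vanishes_above (delta f x).
  suff : [set x | vanishes_above (delta f x)] = [set: G].
    by move/seteqP => [_ /(_ x I)].
  apply: S_gen => /=.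
  - by exists 0 => h _; rewrite /delta mulg1 addbb.
  - exact: vanishes_above_deltaM.
  - exact: vanishes_above_deltaV.
  move=> s Ss; exists (Num.max 0 (- phi s)) => h; rewrite ge_max => /andP[Uh Uhs].
  have hhs : clos_refl_trans G adj h (h * s)%g.
    by apply: rt_step; split=> //; [rewrite /U /= phiM; lra|exists s => //; left].
  rewrite /delta /f; case: asboolP => [hhs0|hhs0]; case: asboolP => // hh0.
    by case: hh0; apply: rt_trans hhs0 _; exact: clos_sym.
  by case: hhs0; exact: rt_trans hh0 hhs.
(* Steps along this generator or its inverse will be used to climb; it exists as otherwise [phi]
   would vanish on [G]. *)
have [z Sz phiz] : exists2 z, S z & phi z != 0.
  apply: contrapT => /forall2NP nS.
  suff : [set x | phi x = 0] = [set: G].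
    by move/seteqP => [_ /(_ x0 I)] /= e; rewrite e eqxx in phix0.
  apply: S_gen => /=; first exact: character1.
  - by move=> x y x0' y0; rewrite phiM x0' y0 addr0.
  - by move=> x x0'; rewrite characterV x0' oppr0.
  - by move=> x Sx; case: (nS x) => // /negP; rewrite negbK => /eqP.
have climb1 h : U h -> exists2 k, clos_refl_trans G adj h k &
    phi k = phi h + `|phi z|.
  move=> Uh; have Uk : 0 <= phi h + `|phi z| by apply: addr_ge0.
  have [z0|z0] := leP 0 (phi z).
    have e : phi (h * z)%g = phi h + `|phi z| by rewrite phiM ger0_norm.
    exists (h * z)%g => //; apply: rt_step; split; rewrite /U /= ?e//.
    by exists z => //; left.
  have e : phi (h * z^-1)%g = phi h + `|phi z| by rewrite phiM characterV ltr0_norm.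
  exists (h * z^-1)%g => //; apply: rt_step; split; rewrite /U /= ?e//.
  by exists z => //; right; rewrite mulgVK.
have climb h C : U h -> exists2 k, clos_refl_trans G adj h k & C <= phi k.
  move=> Uh; have [n Cn] := exists_natr_ge ((C - phi h) / `|phi z|).
  suff [k hk phik] : exists2 k, clos_refl_trans G adj h k &
      phi k = phi h + n%:R * `|phi z|.
    exists k => //; rewrite phik -lerBlDl -ler_pdivrMr//.
    by rewrite normr_gt0.
  elim: n {Cn} => [|n [k hk ek]].
    by exists h; [exact: rt_refl|rewrite mul0r addr0].
  have [|l kl el] := climb1 k.
    by rewrite /U /= ek addr_ge0// mulr_ge0.
  exists l; first exact: rt_trans hk kl.
  by rewrite el ek -natr1 mulrDl mul1r addrA.
have [C [e fe]] := H f Hf.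
have [h1 hh1 Ch1] := climb h0 C Uh0; have [k1 kk1 Ck1] := climb k0 C Uk0.
have := fe _ Ch1; rewrite -(fe _ Ck1) /f (asboolT hh1) => /esym/asboolP hk1.
by apply: rt_trans hk1 _; exact: clos_sym.
Qed.

End Characters.

Section LeadingTerms.
Context (R : realType) (G : groupType) (phi : G -> R).
Hypothesis phiM : forall x y, phi (x * y)%g = (phi x + phi y)%R.
Local Open Scope ring_scope.
(** Here [V] stands for the action of the series, [w] for its terms of minimal value [m], and [d]
    for a gap between [m] and the values of the other terms. *)
Context (V : (G -> bool) -> G -> bool) (w : seq G) (m d : R).
Hypothesis V_add : forall f1 f2, vanishes_above phi f1 -> vanishes_above phi f2 ->
  forall h, V (fun z => f1 z (+) f2 z) h = V f1 h (+) V f2 h.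
Hypothesis phi_w : forall x, x \in w -> phi x = m.
Hypothesis d_gt0 : 0 < d.
Hypothesis V_lead : forall f h, vanishes_above phi f ->
  (forall z, phi h + m + d <= phi z -> f z = false) -> V f h = wsum w f h.
Hypothesis w_surj : forall c : G -> bool, exists a, forall h, wsum w a h = c h.

(* A solution [f] of [V f = 0] restricts to a solution of [w a = 0] on a slab
   just below the supremum of its support. Conversely, a solution of [w a = 0]
   on one level set of [phi] is extended downwards by slabs of width [d]. *)
Lemma leading_kernel :
  (exists f, [/\ vanishes_above phi f, exists h, f h & forall h, V f h = false])
  <-> exists a : G -> bool, (exists h, a h) /\ forall h, wsum w a h = false.
Proof.
split=> [[f [fC [h1 fh1] Vf]]|[a [[h1 ah1] wa]]].
  have [C HC] := fC.
  (* For the least such index [n.+1], [f] vanishes from level [C - n * d] on, but not on the slab of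
     width [d] below, where [V] only sees [w]. *)
  have /ex_minnP[[|n]] : exists n, `[< exists h, f h /\ C - n%:R * d <= phi h >].
  - have [n Hn] := exists_natr_ge ((C - phi h1) / d).
    exists n; apply/asboolP; exists h1; split=> //.
    by move: Hn; rewrite ler_pdivrMr//; lra.
  - by move=> /asboolP[h]; rewrite mul0r subr0 => -[fh /HC]; rewrite fh.
  move=> /asboolP[h2 [fh2 Ch2]] nmin.
  have fn h : C - n%:R * d <= phi h -> f h = false.
    move=> Ch; apply/negP => fh.
    by have := nmin n; rewrite ltnn => /(_ (asboolT (ex_intro _ h (conj fh Ch)))).
  have nd : n.+1%:R * d = n%:R * d + d by rewrite -natr1 mulrDl mul1r.
  exists (fun h => f h && (C - n.+1%:R * d <= phi h)); split.
    by exists h2; rewrite fh2.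
  move=> h; have [Ch|Ch] := leP (C - n.+1%:R * d) (phi h + m).
    rewrite -(Vf h) (V_lead fC); last by move=> z hz; apply: fn; lra.
    by apply: eq_wsum => x xw; rewrite phiM (phi_w xw) Ch andbT.
  by apply: wsum0 => x xw; rewrite phiM (phi_w xw) leNgt Ch andbF.
have [inv Hinv] := choice w_surj.
pose r := phi h1.
(* Starting from the part of [a] at level [r], each correction solves [w b = V (A k)], cut off to
   levels at most [r - k.+1 * d], and so cancels the error on the next slab. *)
pose A := fix A n : G -> bool := if n is k.+1 then
  fun h => A k h (+) (inv (V (A k)) h && (phi h <= r - k.+1%:R * d))
  else fun h => a h && (phi h == r).
have Ar n h : r < phi h -> A n h = false.
  move=> rh; elim: n => [|n IH] /=; first by rewrite gt_eqF ?andbF.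
  rewrite IH leNgt (_ : (_ < _) = true) ?andbF//; apply: le_lt_trans rh.
  by rewrite gerBl mulr_ge0// ltW.
have Avan n : vanishes_above phi (A n).
  by exists (r + 1) => h rh; apply: Ar; lra.
pose B n h := inv (V (A n)) h && (phi h <= r - n.+1%:R * d).
have Bvan n : vanishes_above phi (B n).
  exists (r - n.+1%:R * d + 1) => h rh; rewrite /B leNgt (_ : (_ < _) = true) ?andbF//.
  lra.
have VA n h : r - n.+1%:R * d < phi h + m -> V (A n) h = false.
  elim: n h => [|n IH] h nh.
    rewrite V_lead//; last by move=> z hz; apply: Ar; lra.
    have [hr|hr] := eqVneq (phi h + m) r.
      rewrite -(wa h); apply: eq_wsum => x xw /=.
      by rewrite phiM (phi_w xw) hr eqxx andbT.
    by apply: wsum0 => x xw /=; rewrite phiM (phi_w xw) (negPf hr) andbF.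
  have -> : A n.+1 = fun h => A n h (+) B n h by [].
  rewrite V_add//.
  have nd : n.+2%:R * d = n.+1%:R * d + d by rewrite -natr1 mulrDl mul1r.
  rewrite [V (B n) h]V_lead//; last first.
    move=> z hz; rewrite /B leNgt (_ : (_ < _) = true) ?andbF//; lra.
  have [hr|hr] := leP (phi h + m) (r - n.+1%:R * d).
    have -> : wsum w (B n) h = wsum w (inv (V (A n))) h.
      by apply: eq_wsum => x xw; rewrite /B phiM (phi_w xw) hr andbT.
    by rewrite Hinv addbb.
  rewrite IH// addFb; apply: wsum0 => x xw.
  by rewrite /B phiM (phi_w xw) leNgt hr andbF.
have Astable n k z : r - n.+1%:R * d < phi z -> (n <= k)%N -> A k z = A n z.
  move=> nz; elim: k => [|k IH]; first by rewrite leqn0 => /eqP->.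
  rewrite leq_eqVlt => /predU1P[->//|nk]; rewrite /= IH//.
  rewrite leNgt (_ : (_ < _) = true) ?andbF ?addbF//.
  apply: le_lt_trans nz; rewrite lerD2l lerN2 ler_pM2r// ler_nat.
  exact: leq_trans nk _.
have nn_ex v : exists n, r - n.+1%:R * d < v.
  have [n Hn] := exists_natr_ge ((r - v) / d); exists n.
  have nd : n.+1%:R * d = n%:R * d + d by rewrite -natr1 mulrDl mul1r.
  by move: Hn d_gt0; rewrite ler_pdivrMr// nd; lra.
have [nn Hnn] := choice (fun z => nn_ex (phi z)).
(* The limit of the [A n]: above level [r - n.+1 * d] no later correction is felt. *)
pose f z := A (nn z) z.
have fA n z : r - n.+1%:R * d < phi z -> f z = A n z.
  move=> nz; rewrite /f; have [nk|/ltnW kn] := leqP n (nn z).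
    exact: Astable.
  by rewrite [RHS](Astable (nn z)).
have fvan : vanishes_above phi f by exists (r + 1) => h rh; apply: Ar; lra.
exists f; split=> //.
  exists h1; rewrite (fA 0%N) ?mul1r /= ?ah1 ?eqxx//.
  by rewrite ltrBlDr ltrDl.
move=> h; have [n nh] := nn_ex (phi h + m).
have nd : n.+1%:R * d = n%:R * d + d by rewrite -natr1 mulrDl mul1r.
have Df z : r - n.+1%:R * d < phi z -> f z (+) A n z = false.
  by move=> zn; rewrite (fA _ _ zn) addbb.
have -> : f = fun z => A n z (+) (f z (+) A n z).
  by apply/funext => z; rewrite addbC -addbA addbb addbF.
rewrite V_add//; last exact: vanishes_above_add.
rewrite VA// addFb V_lead; last by move=> z hz; apply: Df; move: d_gt0 nh; lra.
  by apply: wsum0 => x xw; apply: Df; rewrite phiM (phi_w xw).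
exact: vanishes_above_add.
Qed.

End LeadingTerms.

(** * The Novikov series and its faces *)

(** The limit of an eventually constant sequence of bits, made total so that series act on all
    functions. *)
Definition eventually_true (s : nat -> bool) : bool :=
  `[< exists N0, forall N, N0 <= N -> s N >].

Lemma eventually_trueE s e N0 :
  (forall N, N0 <= N -> s N = e) -> eventually_true s = e.
Proof.
move=> H; rewrite /eventually_true; case: asboolP => [[N1 H1]|nH].
  by rewrite -(H (maxn N0 N1)) ?leq_maxl// H1 ?leq_maxr.
case: e H => // H; case: nH; exists N0 => N /H ->//.
Qed.

Lemma wsum_perm (G : groupType) (l1 l2 : seq G) f h :
  perm_eq l1 l2 -> wsum l1 f h = wsum l2 f h.
Proof. exact: perm_big. Qed.

Lemma seq_gap (R : realType) (T : eqType) (s : seq T) (c : T -> R) (m : R) :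
  (forall x, x \in s -> m < c x)%R ->
  exists d, [/\ (0 < d)%R, (d <= 1)%R & forall x, x \in s -> (m + d <= c x)%R].
Proof.
elim: s => [|x s IH] H; first by exists 1%R; rewrite ltr01 lexx.
have [|d [d0 d1 Hd]] := IH; first by move=> y ys; apply: H; rewrite inE ys orbT.
have mx := H x (mem_head _ _).
exists (Num.min d (c x - m)%R); split.
- by rewrite lt_min d0 subr_gt0.
- by rewrite ge_min d1.
move=> y; rewrite inE => /predU1P[->|/Hd].
  by rewrite -lerBrDl ge_min lexx orbT.
by apply: le_trans; rewrite lerD2l ge_min lexx.
Qed.

Lemma seq_argmin (R : realType) (T : eqType) (s : seq T) (c : T -> R) x0 :
  x0 \in s -> exists2 x, x \in s & forall y, y \in s -> (c x <= c y)%R.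
Proof.
elim: s x0 => // x [|x' s] IH x0 _.
  by exists x; rewrite ?mem_head// => y; rewrite inE => /eqP->.
have [z zs Hz] := IH x' (mem_head _ _).
have [xz|zx] := leP (c x) (c z).
  exists x; rewrite ?mem_head// => y; rewrite in_cons => /predU1P[->//|/Hz].
  exact: le_trans.
exists z => [|y]; rewrite in_cons ?zs ?orbT// => /predU1P[->|/Hz//].
exact: ltW.
Qed.

Definition odd_part (T : eqType) (l : seq T) : seq T :=
  [seq x <- undup l | odd (count_mem x l)].

Lemma wsum_odd_part (G : groupType) (l : seq G) f h :
  wsum (odd_part l) f h = wsum l f h.
Proof.
rewrite /wsum -[RHS]big_undup_iterop_count big_filter big_mkcond /=.
apply: eq_bigr => x _; rewrite Monoid.iteropE.
by elim: (count_mem x l) => //= n <-; case: odd; case: (f _).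
Qed.

Section Operator.
Context (X : choiceType) (g : {multiplicative free_group X -> free_group X}).
Context (j : X) (c : free_group X).
Local Notation F := (free_group X).
Local Notation G := (hnn g).
Local Notation emb := (@hnn_base F g).
Local Notation t := (hnn_stable g).
Local Notation fox := (@fox X j).
Local Notation gen := (fgen j).

(** With [fox_c], this expresses that [gen] and [c] form a basis: they generate [F], and the
    derivative of [c] with respect to [gen] acts as zero. *)
Hypothesis basis_ind : forall H : F -> Prop,
  (forall x y, H x -> H y -> H (x * y)%g) -> (forall x, H x -> H x^-1%g) ->
  H c -> H gen -> forall x, H x.
Hypothesis g_inj : injective g.
Hypothesis fox_c : forall f h, wsum [seq emb y | y <- fox c] f h = false.

Let gd := emb (g gen).
Let gc := emb (g c).
Let A := [seq emb y | y <- fox (g gen)].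
Let B := [seq emb y | y <- fox (g c)].

Let block n := [seq gc ^+ n * y | y <- B]%g ++ [seq gd * gc ^+ n * y | y <- B]%g.

(* Truncations of the formal series
   [t^-1 + A + (1 + g(gen)) * \sum_n g(c)^n * B], where [A] and [B] are the
   Fox derivatives of [g gen] and [g c] with respect to [gen]: this is what
   remains of the Fox matrix of the presentation once the column of [t] has
   been eliminated, which requires inverting [c - 1]. *)
Fixpoint terms N := if N is n.+1 then terms n ++ block n else (t^-1)%g :: A.

Definition series_op (f : G -> bool) (h : G) : bool :=
  eventually_true (fun N => wsum (terms N) f h).

Definition series_coef (x : G) : bool :=
  eventually_true (fun N => odd (count_mem x (terms N))).

Let sumB N f h := \big[addb/false]_(n < N) wsum B f (h * gc ^+ n)%g.

Let wsum_terms N f h : wsum (terms N) f h =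
  f (h * t^-1)%g (+) wsum A f h (+) sumB N f h (+) sumB N f (h * gd)%g.
Proof.
elim: N => [|N IH] /=; first by rewrite wsum_cons /sumB !big_ord0 !addbF.
rewrite wsum_cat IH /block wsum_cat !wsum_mul /sumB !big_ord_recr /= mulgA.
by rewrite addbACA !addbA.
Qed.

Let terms_cat N0 N : N0 <= N -> exists2 l, terms N = terms N0 ++ l &
  forall x, x \in l -> exists2 n, N0 <= n & x \in block n.
Proof.
elim: N => [|N IH]; first by rewrite leqn0 => /eqP->; exists [::]; rewrite ?cats0.
rewrite leq_eqVlt => /predU1P[->|]; first by exists [::]; rewrite ?cats0.
move=> N0N; have [l /= -> Hl] := IH N0N; exists (l ++ block N) => [|x].
  exact/esym/catA.
by rewrite mem_cat => /orP[/Hl|xb] //; exists N.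
Qed.

Let emb_conj_mul x h : (h * emb (g x) * t^-1 = h * t^-1 * emb x)%g.
Proof.
rewrite -!mulgA; congr (_ * _)%g; apply: (mulgI t).
by rewrite mulVKg mulgA -hnn_base_conj mulgK.
Qed.

Definition base : seq G := t^-1%g :: A ++ B ++ [seq (gd * y)%g | y <- B].

Context (R : realType).

(** To every character, a term [gc ^+ k * y] looks like [y * emb c ^+ k], because [gc] is conjugate
    to [emb c] by [t]. Hence finitely many columns, starting at [base], carry the support. *)
Definition column (i : 'I_(size base)) (k : nat) (x : G) :=
  forall psi : G -> R, (forall y z, psi (y * z)%g = psi y + psi z)%R ->
    psi x = (psi (nth 1%g base i) + psi (emb c) *+ k)%R.

(** When [c] is positive, a column can meet the face only in its lowest support elements, so the
    finite datum [J] determines the face. *)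
Definition lowest (J : {set 'I_(size base)}) (x : G) := exists i k,
  [/\ i \in J, column i k x &
      forall x' k', series_coef x' -> column i k' x' -> k <= k'].

(* The characters positive on [c] whose face of the support of the series
   consists of the lowest points of the columns in [J]. *)
Definition piece J (psi : G -> R) := [/\ (0 < psi (emb c))%R,
  exists x, series_coef x /\ lowest J x &
  exists m, forall x, series_coef x ->
    (m <= psi x)%R /\ (psi x = m <-> lowest J x)].

(** Both characters attain their minimum over the support exactly on [lowest J], hence so does the
    combination. Equality is traced back to [psi1], which needs [a > 0]; for [a = 0] the combination
    is [psi2]. *)
Lemma piece_convex J (psi1 psi2 : G -> R) (a b : R) :
  piece J psi1 -> piece J psi2 -> (0 <= a)%R -> (0 <= b)%R -> (a + b = 1)%R ->
  piece J (fun x => a * psi1 x + b * psi2 x)%R.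
Proof.
move=> [c1 JN [m1 H1]] [c2 _ [m2 H2]] a0 b0 ab.
have [a_gt0|a_le0] := ltP 0%R a; last first.
  have -> : (fun x => a * psi1 x + b * psi2 x)%R = psi2.
    have -> : b = 1%R by lra.
    have -> : a = 0%R by lra.
    by apply/funext => x; rewrite mul0r add0r mul1r.
  by split=> //; exists m2.
split=> //; first by rewrite ltr_pwDl ?mulr_gt0// mulr_ge0// ltW.
exists (a * m1 + b * m2)%R => x /[dup] /H1[m1x e1] /H2[m2x e2].
have am1 : (a * m1 <= a * psi1 x)%R by rewrite ler_wpM2l.
have bm2 : (b * m2 <= b * psi2 x)%R by rewrite ler_wpM2l.
split; first exact: lerD.
split=> [e|xJ]; last by rewrite (e1.2 xJ) (e2.2 xJ).
apply/e1; have /(mulfI _) : (a * psi1 x = a * m1)%R by lra.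
by apply; rewrite gt_eqF.
Qed.

Section PositiveCharacter.
Context (phi : G -> R).
Hypothesis phiM : forall x y, phi (x * y)%g = (phi x + phi y)%R.
Hypothesis phi_c : (0 < phi (emb c))%R.
Local Open Scope ring_scope.

Let phi_gc : phi gc = phi (emb c).
Proof.
apply: (addrI (phi t)); rewrite -[RHS]addrC -!phiM.
by rewrite (hnn_base_conj g c).
Qed.

Let phi_gc_gt0 : 0 < phi gc. Proof. by rewrite phi_gc. Qed.

Let vanishes_wsum l f : vanishes_above phi f -> vanishes_above phi (wsum l f).
Proof.
move=> fv; elim: l => [|x l IH].
  by exists 0 => h _; rewrite wsum_nil.
apply: eq_vanishes_above (vanishes_above_add (vanishes_above_shift phiM x fv) IH).
by move=> h; rewrite wsum_cons.
Qed.

(** Convergence in the Novikov sense, due to [phi gc > 0]. *)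
Let block_ge K : exists N0, forall n x, (N0 <= n)%N -> x \in block n -> K <= phi x.
Proof.
have [C HC] := seq_ubound B (fun y => - phi y).
have [N0 HN0] := exists_natr_ge ((K + C - Num.min 0 (phi gd)) / phi gc).
exists N0 => n x N0n xb.
have nC : K + C - Num.min 0 (phi gd) <= n%:R * phi gc.
  rewrite -ler_pdivrMr//; apply: le_trans HN0 _; by rewrite ler_nat.
have m1 : Num.min 0 (phi gd) <= 0 by rewrite ge_min lexx.
have m2 : Num.min 0 (phi gd) <= phi gd by rewrite ge_min lexx orbT.
move: xb; rewrite mem_cat => /orP[] /mapP[y /HC yC ->].
  by rewrite phiM (characterX phiM) -mulr_natl; lra.
by rewrite !phiM (characterX phiM) -mulr_natl; lra.
Qed.

Let sumB_stable f h : vanishes_above phi f ->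
  exists N0, forall N, (N0 <= N)%N -> sumB N f h = sumB N0 f h.
Proof.
move=> /(vanishes_wsum B)[C HC].
have [N0 HN0] := exists_natr_ge ((C - phi h) / phi gc).
exists N0; elim=> [|N IH]; first by rewrite leqn0 => /eqP->.
rewrite leq_eqVlt => /predU1P[->//|N0N]; rewrite -IH// /sumB big_ord_recr /=.
rewrite HC ?addbF// phiM (characterX phiM) -mulr_natl -lerBlDl -ler_pdivrMr//.
by apply: le_trans HN0 _; rewrite ler_nat.
Qed.

(** The geometric series [\sum_n gc^n * B] applied to [f]; it inverts [1 + gc] by telescoping, as
    [sg_gc] records. *)
Let sg f h := eventually_true (fun N => sumB N f h).

Let sg_stable f h : vanishes_above phi f ->
  exists N0, forall N, (N0 <= N)%N -> sumB N f h = sg f h.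
Proof.
move=> fv; have [N0 HN0] := sumB_stable h fv; exists N0 => N N0N.
by rewrite HN0//; apply/esym/eventually_trueE; exact: HN0.
Qed.

Let terms_stable f h : vanishes_above phi f -> exists N0, forall N, (N0 <= N)%N ->
  wsum (terms N) f h = f (h * t^-1)%g (+) wsum A f h (+) sg f h (+) sg f (h * gd)%g.
Proof.
move=> fv; have [N1 HN1] := sg_stable h fv.
have [N2 HN2] := sg_stable (h * gd)%g fv.
exists (maxn N1 N2) => N; rewrite geq_max => /andP[N1N N2N].
by rewrite wsum_terms HN1// HN2.
Qed.

Let series_opE f h : vanishes_above phi f -> series_op f h =
  f (h * t^-1)%g (+) wsum A f h (+) sg f h (+) sg f (h * gd)%g.
Proof.
by move=> fv; have [N0 HN0] := terms_stable h fv; exact: eventually_trueE HN0.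
Qed.

Let series_op_stable f h : vanishes_above phi f ->
  exists N0, forall N, (N0 <= N)%N -> wsum (terms N) f h = series_op f h.
Proof.
move=> fv; have [N0 HN0] := terms_stable h fv; exists N0 => N /HN0->.
by rewrite series_opE.
Qed.

Lemma series_op_add f1 f2 : vanishes_above phi f1 -> vanishes_above phi f2 ->
  forall h, series_op (fun z => f1 z (+) f2 z) h = series_op f1 h (+) series_op f2 h.
Proof.
move=> f1v f2v h; have [N1 HN1] := series_op_stable h f1v.
have [N2 HN2] := series_op_stable h f2v.
apply: (eventually_trueE (N0 := maxn N1 N2)) => N; rewrite geq_max => /andP[N1N N2N].
by rewrite wsum_add HN1// HN2.
Qed.

Let sg_gc f h : vanishes_above phi f -> sg f (h * gc)%g (+) sg f h = wsum B f h.
Proof.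
move=> fv; have [N1 HN1] := sg_stable h fv.
have [N2 HN2] := sg_stable (h * gc)%g fv.
have N12 : (N1 <= (maxn N1 N2).+1)%N by rewrite leqW// leq_maxl.
rewrite -(HN1 _ N12) -(HN2 (maxn N1 N2)) ?leq_maxr//.
rewrite (_ : sumB _.+1 f h = wsum B f h (+) sumB (maxn N1 N2) f (h * gc)%g).
  by rewrite addbCA addbb addbF.
rewrite /sumB big_ord_recl /= expg0 mulg1; congr (_ (+) _).
by apply: eq_bigr => i _; rewrite /bump /= add1n expgS mulgA.
Qed.

Let sg_vanishes f : vanishes_above phi f -> vanishes_above phi (sg f).
Proof.
move=> fv; have [C HC] := vanishes_wsum B fv; exists C => h Ch.
apply: (eventually_trueE (N0 := 0%N)) => N _.
rewrite /sumB big1// => i _; apply: HC; rewrite phiM (characterX phiM).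
by apply: (le_trans Ch); rewrite lerDl mulrn_wge0// ltW.
Qed.


Let D f x h := wsum [seq emb y | y <- fox x] f h.

Let DM f x y h : D f (x * y)%g h = D f x h (+) D f y (h * emb x)%g.
Proof. exact: wsum_foxM. Qed.

Let D_gen f h : D f gen h = f h.
Proof. by rewrite /D wsum_fox_gen eqxx. Qed.

(** A kernel element [f] integrates to a function [k] whose differences are the Fox derivatives
    along the base and a shift of [sg f] along [t]. Were [k] constant at high levels, its
    [c]-invariance would make it constant everywhere, forcing [f = 0]. *)
Let no_limit_of_kernel f : vanishes_above phi f -> (exists h, f h) ->
  (forall h, series_op f h = false) -> ~ eventually_constant_criterion phi.
Proof.
move=> fv [h0 fh0] Vf crit.
have DV x h : D f x^-1%g h = D f x (h * emb x^-1)%g by exact: wsum_foxV.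
(* Compatibility with the relations [t^-1 x t = g x]: for [c] it is the telescoping of [sg], for
   [gen] it is the kernel equation, and it passes to products and inverses. *)
have sgD x h : sg f h (+) D f x (h * t^-1)%g (+) sg f (h * emb (g x))%g = D f (g x) h.
  elim/basis_ind: x h => [x y Hx Hy|x Hx||] h.
  - rewrite gmulfM !DM -Hx -Hy emb_conj_mul (hnn_baseM _ (g x)) mulgA.
    by case: (sg f h); case: (D f x _); case: (D f y _); case: (sg f _);
      case: (sg f _).
  - have e := Hx (h * emb (g x^-1))%g.
    rewrite emb_conj_mul -DV -mulgA -hnn_baseM -gmulfM mulVg !group_morph1 in e.
    rewrite mulg1 [g x^-1%g]group_morphV -DV in e.
    rewrite [g x^-1%g]group_morphV -e addbAC.
    by rewrite [in RHS]addbAC [X in X (+) _ = _]addbC.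
  - by rewrite /D fox_c addbF addbC; exact: sg_gc.
  - rewrite D_gen; have := Vf h; rewrite (series_opE _ fv).
    rewrite -[wsum A f h]/(D f (g gen) h) -/gd.
    move: (f _) (D f (g gen) h) (sg f (h * gd)%g) (sg f h).
    by move=> [] [] [] [].
have [k [kb kt]] := hnn_cocycle (DM f) sgD.
have kv x : vanishes_above phi (delta k x).
  elim/hnn_ind: x => [x y|x|x|].
  - exact: vanishes_above_deltaM.
  - exact: vanishes_above_deltaV.
  - apply: eq_vanishes_above (vanishes_wsum _ fv) => h.
    by rewrite /delta kb.
  - apply: eq_vanishes_above (vanishes_above_shift phiM t (sg_vanishes fv)) => h.
    by rewrite /delta kt.
have [C [e ke]] := crit k kv.
have kc h n : k (h * emb c ^+ n)%g = k h.
  elim: n => [|n IH]; first by rewrite expg0 mulg1.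
  rewrite expgSr mulgA -IH; apply: addb_eqF; rewrite kb; exact: fox_c.
have k_const h : k h = e.
  have [n Hn] := exists_natr_ge ((C - phi h) / phi (emb c)).
  rewrite -(kc h n) ke// phiM (characterX phiM) -mulr_natl -lerBlDl.
  by rewrite -ler_pdivrMr.
by have := kb gen h0; rewrite !k_const addbb -/(D f gen h0) D_gen fh0.
Qed.

Let kernel_of_no_limit : ~ eventually_constant_criterion phi ->
  exists f, [/\ vanishes_above phi f, exists h, f h &
                forall h, series_op f h = false].
Proof.
move=> /existsNP[k0 /not_implyP[k0v k0N]].
have [C HC] := k0v (emb c).
have stable h n : C <= phi h -> k0 (h * emb c ^+ n)%g = k0 h.
  move=> Ch; elim: n => [|n <-]; first by rewrite expg0 mulg1.
  rewrite expgSr mulgA; apply/addb_eqF/HC.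
  by rewrite phiM (characterX phiM) (le_trans Ch)// lerDl mulrn_wge0// ltW.
(* Normalisation to a [c]-invariant function: the limit exists since [k0] is [c]-invariant above
   [C], where [k] agrees with it. *)
pose k h := eventually_true (fun n => k0 (h * emb c ^+ n)%g).
have kE h : exists n0, forall n, (n0 <= n)%N -> k0 (h * emb c ^+ n)%g = k h.
  have [n0 Hn0] := exists_natr_ge ((C - phi h) / phi (emb c)).
  have hn n : (n0 <= n)%N -> k0 (h * emb c ^+ n)%g = k0 (h * emb c ^+ n0)%g.
    move=> /subnKC <-; rewrite expgnDr mulgA stable//.
    by rewrite phiM (characterX phiM) -mulr_natl -lerBlDl -ler_pdivrMr.
  exists n0 => n /hn ->; apply/esym/eventually_trueE; exact: hn.
have kk0 h : C <= phi h -> k h = k0 h.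
  by move=> Ch; have [n0 /(_ n0 (leqnn _)) <-] := kE h; exact: stable.
have kc h : k (h * emb c)%g = k h.
  have [n1 H1] := kE h; have [n2 H2] := kE (h * emb c)%g.
  rewrite -(H2 (maxn n1 n2)) ?leq_maxr// -(H1 (maxn n1 n2).+1).
    by rewrite expgS mulgA.
  by rewrite leqW// leq_maxl.
have kv x : vanishes_above phi (delta k x).
  have [C' HC'] := k0v x; exists (Num.max C' (Num.max C (C - phi x))) => h.
  rewrite !ge_max => /and3P[C'h Ch Cxh]; rewrite /delta !kk0//; first exact: HC'.
  by rewrite phiM; lra.
have kN C1 e : ~ forall h, C1 <= phi h -> k h = e.
  move=> ke; apply: k0N; exists (Num.max C1 C), e => h.
  by rewrite ge_max => /andP[C1h Ch]; rewrite -kk0// ke.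
pose f := delta k (emb gen); pose s h := k h (+) k (h * t^-1)%g.
have DE x h : D f x h = delta k (emb x) h.
  elim/basis_ind: x h => [x y Hx Hy|x Hx||] h.
  - rewrite DM Hx Hy /delta gmulfM mulgA addbC -addbA.
    by rewrite (addbA (k (h * emb x)%g)) addbb addFb.
  - rewrite /D wsum_foxV -/(D f x _) Hx /delta -mulgA.
    by rewrite -hnn_baseM mulVg group_morph1 mulg1 addbC.
  - by rewrite /D fox_c /delta kc addbb.
  - by rewrite D_gen.
have s_gc h : s (h * gc)%g (+) s h = wsum B f h.
  rewrite -[RHS]/(D f (g c) h) DE /s /delta -/gc emb_conj_mul kc.
  by rewrite addbACA addbb addbF.
have sv : vanishes_above phi s.
  apply: eq_vanishes_above (vanishes_above_shift phiM t^-1 (kv t)) => h.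
  by rewrite /delta mulgVK.
have s_gcn h n : s (h * gc ^+ n)%g (+) s h = sumB n f h.
  elim: n => [|n IH]; first by rewrite expg0 mulg1 addbb /sumB big_ord0.
  rewrite /sumB big_ord_recr /= -/(sumB n f h) -IH -s_gc expgSr mulgA.
  by case: (s _); case: (s _); case: (s _).
have s_far h : exists n0, forall n, (n0 <= n)%N -> s (h * gc ^+ n)%g = false.
  have [C1 HC1] := sv; have [n0 Hn0] := exists_natr_ge ((C1 - phi h) / phi gc).
  exists n0 => n n0n; apply: HC1.
  rewrite phiM (characterX phiM) -mulr_natl -lerBlDl -ler_pdivrMr//.
  by apply: le_trans Hn0 _; rewrite ler_nat.
(* The differences of [s] along [gc] are given by [B], and [s] vanishes far up, so [s] is the
   geometric series. *)
have sgE h : sg f h = s h.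
  have [n0 Hn0] := s_far h; apply: (eventually_trueE (N0 := n0)) => n n0n.
  by rewrite -s_gcn Hn0.
exists f; split; first exact: kv.
(* If [f = 0], then [k] is invariant under the base and, as [s = 0], under [t]; being constant, it
   contradicts the choice of [k0]. *)
- apply: contrapT => /forallNP f0.
  have {}f0 : f = fun=> false by apply/funext => h; apply/negbTE/negP/f0.
  have s0 h : s h = false.
    have [n0 Hn0] := s_far h; have := s_gcn h n0; rewrite Hn0//.
    rewrite addFb => ->; rewrite /sumB big1// => i _.
    by apply: wsum0 => x _; rewrite f0.
  apply: (kN 0 (k 1%g)) => h _.
  suff H x y : k (y * x)%g = k y by rewrite -(H h 1%g) mul1g.
  elim/hnn_ind: x y => [x x' Hx Hx'|x Hx|x|] y.
  + by rewrite mulgA Hx' Hx.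
  + by rewrite -(Hx (y * x^-1)%g) mulgVK.
  + by apply: addb_eqF; rewrite -[LHS]DE /D; apply: wsum0 => z _; rewrite f0.
  + by apply: addb_eqF; have := s0 (y * t)%g; rewrite /s mulgK.
move=> h; rewrite (series_opE _ (kv _)) !sgE -[wsum A f h]/(D f (g gen) h) DE.
rewrite /f /s /delta emb_conj_mul -/gd.
move: (k (h * t^-1 * _)%g) (k (h * t^-1)%g) (k (h * gd)%g) (k h).
by move=> [] [] [] [].
Qed.

Lemma eventually_constant_criterionP : eventually_constant_criterion phi <->
  ~ exists f, [/\ vanishes_above phi f, exists h, f h &
                forall h, series_op f h = false].
Proof.
split=> [crit [f [fv fN Vf]]|noker]; first exact: no_limit_of_kernel Vf crit.
by apply: contrapT => /kernel_of_no_limit.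
Qed.

Let block_emb n x : x \in block n -> exists y, x = emb y.
Proof.
rewrite mem_cat => /orP[] /mapP[_ /mapP[y _ ->] ->].
  by exists (g c ^+ n * y)%g; rewrite gmulfM group_morphX.
by exists (g gen * g c ^+ n * y)%g; rewrite !gmulfM group_morphX.
Qed.

Let terms_emb N x : x \in terms N -> x = t^-1%g \/ exists y, x = emb y.
Proof.
elim: N => [|N IH] /=.
  rewrite inE => /predU1P[->|/mapP[y _ ->]]; first by left.
  by right; exists y.
by rewrite mem_cat => /orP[/IH//|/block_emb]; right.
Qed.

Let series_coef_stable K : exists N0, forall N x, (N0 <= N)%N -> phi x < K ->
  odd (count_mem x (terms N)) = series_coef x.
Proof.
have [N0 HN0] := block_ge K; exists N0 => N x N0N xK.
have H M : (N0 <= M)%N ->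
    odd (count_mem x (terms M)) = odd (count_mem x (terms N0)).
  move=> N0M; have [l -> Hl] := terms_cat N0M.
  rewrite count_cat (_ : count_mem x l = 0%N) ?addn0//.
  apply/count_memPn/negP => /Hl[n N0n xb].
  by have := HN0 n x N0n xb; rewrite leNgt xK.
by rewrite H//; apply/esym/eventually_trueE; exact: H.
Qed.

(** All other terms have exponent sum 0 and cannot cancel [t^-1], so the support is never empty. *)
Let series_coef_stable_letter : series_coef t^-1%g.
Proof.
apply: (eventually_trueE (N0 := 0%N)) => N _.
have expV : hnn_exp t^-1%g = (-1)%R.
  have := hnn_expM t t^-1%g; rewrite mulgV hnn_exp_stable.
  by rewrite -(group_morph1 emb) hnn_exp_base; lia.
have tN y : t^-1%g <> emb y.
  by move/(congr1 (@hnn_exp F g)); rewrite expV hnn_exp_base.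
elim: N => [|N IH] /=.
  by rewrite eqxx (count_memPn _) //; apply/negP => /mapP[y _ /tN].
by rewrite count_cat (count_memPn (_ : _ \notin block N)) ?addn0//;
  apply/negP => /block_emb[y /tN].
Qed.

(** The membership clause describes the minimal part [w] through [J] alone, so that all characters
    of a piece share it up to order. *)
Lemma piece_leading J : piece J phi -> exists w : seq G, [/\ uniq w,
  forall x, (x \in w) = series_coef x && `[< lowest J x >] &
  eventually_constant_criterion phi <->
  ~ exists a : G -> bool, (exists h, a h) /\ forall h, wsum w a h = false].
Proof.
move=> [_ [x0 [cx0 Jx0]] [m Hm]].
have [N0 HN0] := series_coef_stable (m + 1).
have [N1 HN1] := block_ge (m + 1).
(* After [N2] blocks the coefficients below level [m + 1] are final, and all later blocks lie at
   level at least [m + 1]; this is why the gap [d] is taken at most 1. *)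
pose N2 := maxn N0 N1; pose L := odd_part (terms N2).
pose w := [seq x <- L | phi x == m].
have memL x : x \in L -> phi x < m + 1 -> series_coef x.
  by rewrite mem_filter => /andP[+ _] xm; rewrite (HN0 _ _ _ xm) ?leq_maxl.
have memw x : (x \in w) = series_coef x && `[< lowest J x >].
  rewrite mem_filter; apply/andP/andP => [[/eqP xm xL]|[cx /asboolP Jx]].
    have cx : series_coef x by apply: memL => //; rewrite xm ltrDl.
    by split=> //; apply/asboolP/(Hm x cx).2.
  have xm : phi x = m by apply/(Hm x cx).2.
  have xm1 : phi x < m + 1 by rewrite xm ltrDl.
  rewrite xm eqxx mem_filter (HN0 _ _ _ xm1) ?leq_maxl// cx mem_undup.
  split=> //; rewrite -has_pred1 has_count.
  by have := HN0 N2 x (leq_maxl _ _) xm1; rewrite cx; case: (count_mem x (terms N2)).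
have w_uniq : uniq w by rewrite filter_uniq// filter_uniq// undup_uniq.
exists w; split=> //.
pose L' := [seq x <- L | phi x != m].
have [d [d_gt0 d1 Hd]] : exists d, [/\ 0 < d, d <= 1 &
    forall x, x \in L' -> m + d <= phi x].
  apply: seq_gap => x; rewrite mem_filter lt_neqAle eq_sym => /andP[-> xL] /=.
  have [xm|xm] := ltP (phi x) (m + 1); first exact: (Hm x (memL x xL xm)).1.
  by apply: le_trans xm; rewrite lerDl.
have phi_w x : x \in w -> phi x = m by rewrite mem_filter => /andP[/eqP].
have V_lead f h : vanishes_above phi f ->
    (forall z, phi h + m + d <= phi z -> f z = false) ->
    series_op f h = wsum w f h.
  move=> fv Hf; apply: (eventually_trueE (N0 := N2)) => N N2N.
  have [l -> Hl] := terms_cat N2N; rewrite wsum_cat [wsum l f h]wsum0; last first.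
    move=> x /Hl[n N2n /HN1 xm]; apply: Hf; rewrite phiM -addrA lerD2l.
    have := xm (leq_trans (leq_maxr _ _) N2n); lra.
  rewrite addbF -wsum_odd_part -/L.
  have -> : wsum L f h = wsum (w ++ L') f h.
    by apply: wsum_perm; rewrite perm_sym; exact/permPl/perm_filterC.
  rewrite wsum_cat [wsum L' f h]wsum0 ?addbF// => x /Hd xd.
  by apply: Hf; rewrite phiM -addrA lerD2l.
have w_neq0 : w != [::].
  have : x0 \in w by rewrite memw cx0; apply/asboolP.
  by case: (w).
have w_surj : forall b : G -> bool, exists a, forall h, wsum w a h = b h.
  apply: (hnn_wsum_surj g_inj) => // x; rewrite mem_filter => /andP[_].
  by rewrite mem_filter mem_undup => /andP[_ /terms_emb].
rewrite eventually_constant_criterionP.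
by rewrite (leading_kernel phiM series_op_add phi_w d_gt0 V_lead w_surj).
Qed.

Let nth_base y : y \in base -> exists i : 'I_(size base), nth 1%g base i = y.
Proof.
move=> yb; have ib : (index y base < size base)%N by rewrite index_mem.
by exists (Ordinal ib); rewrite nth_index.
Qed.

Let column_terms N x : x \in terms N -> exists i k, column i k x.
Proof.
have hom (psi : G -> R) : (forall y z, psi (y * z)%g = psi y + psi z) ->
    psi gc = psi (emb c).
  move=> psiM; apply: (addrI (psi t)); rewrite -[RHS]addrC -!psiM.
  by rewrite (hnn_base_conj g c).
elim: N => [|N IH] /=.
  move=> xb; have [|i ix] := nth_base (_ : x \in base).
    by move: xb; rewrite !inE mem_cat => /orP[->|->]; rewrite ?orbT.
  by exists i, 0%N => psi _; rewrite ix addr0.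
rewrite mem_cat => /orP[/IH//|]; rewrite mem_cat => /orP[] /mapP[y yB ->].
  have [|i iy] := nth_base (_ : y \in base).
    by rewrite inE !mem_cat yB !orbT.
  exists i, N => psi psiM; rewrite iy psiM (characterX psiM) hom// addrC//.
have [|i iy] := nth_base (_ : (gd * y)%g \in base).
  by rewrite inE !mem_cat (map_f _ yB) !orbT.
exists i, N => psi psiM; rewrite iy !psiM (characterX psiM) hom//.
by rewrite -!addrA (addrC (psi y)).
Qed.

Lemma piece_cover : exists J, piece J phi.
Proof.
(* As [t^-1] lies in the support, the minimum is attained among the finitely many support elements
   below [K]. *)
pose K := phi t^-1%g + 1.
have [N0 HN0] := series_coef_stable K.
have mem_terms x : series_coef x -> phi x < K -> x \in terms N0.
  move=> cx xK; rewrite -has_pred1 has_count.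
  by have := HN0 N0 x (leqnn _) xK; rewrite cx; case: (count_mem x (terms N0)).
pose L := [seq x <- terms N0 | series_coef x].
have memL x : series_coef x -> phi x < K -> x \in L.
  by move=> cx xK; rewrite mem_filter cx mem_terms.
have tL : t^-1%g \in L.
  by apply: memL; [exact: series_coef_stable_letter|rewrite /K ltrDl].
have [x0 x0L x0min] := seq_argmin phi tL.
have cx0 : series_coef x0 by move: x0L; rewrite mem_filter => /andP[].
have mx x : series_coef x -> phi x0 <= phi x.
  move=> cx; have [xK|xK] := ltP (phi x) K; first exact/x0min/memL.
  by apply: le_trans (x0min _ tL) (le_trans _ xK); rewrite /K lerDl.
have cterms x : series_coef x -> exists i k, column i k x.
  by move=> /asboolP[M /(_ M (leqnn M)) cx]; apply: (@column_terms M);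
    rewrite -has_pred1 has_count; case: (count_mem x (terms M)) cx.
(* The columns through minimal elements. Since [phi] increases with height along a column, those
   elements are its lowest ones. *)
pose J := [set i : 'I_(size base) | `[< exists x k,
  [/\ series_coef x, phi x = phi x0 & column i k x] >]]%SET.
have JE x : series_coef x -> (phi x = phi x0 <-> lowest J x).
  move=> cx; split=> [xm|[i [k [iJ ik kmin]]]].
    have [i [k ik]] := cterms x cx; exists i, k; split=> //.
      by rewrite inE; apply/asboolP; exists x, k.
    move=> x' k' cx' ik'; have := mx x' cx'.
    rewrite -xm (ik phi phiM) (ik' phi phiM) lerD2l.
    by rewrite ler_pMn2l.
  move: iJ; rewrite inE => /asboolP[x' [k' [cx' x'm ik']]].
  apply/eqP; rewrite eq_le mx// andbT -x'm (ik phi phiM) (ik' phi phiM) lerD2l.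
  by rewrite ler_pMn2l// (kmin x').
exists J; split=> //; first by exists x0; split=> //; apply/JE.
by exists (phi x0) => x cx; split; [exact: mx|exact: JE].
Qed.

End PositiveCharacter.

Lemma piece_same J (psi1 psi2 : G -> R) :
  (forall y z, psi1 (y * z)%g = psi1 y + psi1 z)%R ->
  (forall y z, psi2 (y * z)%g = psi2 y + psi2 z)%R ->
  piece J psi1 -> piece J psi2 ->
  eventually_constant_criterion psi1 -> eventually_constant_criterion psi2.
Proof.
move=> psi1M psi2M p1 p2; have [c1 _ _] := p1; have [c2 _ _] := p2.
have [w1 [u1 m1 ->]] := piece_leading psi1M c1 p1.
have [w2 [u2 m2 ->]] := piece_leading psi2M c2 p2.
have w12 : perm_eq w2 w1 by apply: uniq_perm => // x; rewrite m1 m2.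
apply: contra_not => -[a [aN wa]]; exists a; split=> // h.
by rewrite -(wsum_perm _ _ w12) wa.
Qed.

End Operator.

(** * Components of subsets of the character sphere *)

Section SphereComponents.
Context (R : realType) (G : groupType).
Local Open Scope classical_set_scope.
Local Open Scope ring_scope.
Implicit Types (phi : character R G) (P : (G -> R) -> Prop).

Lemma char_funM phi x y : char_fun phi (x * y)%g = char_fun phi x + char_fun phi y.
Proof. by case: phi => f /= fP; case: (set_mem fP) => + _; apply. Qed.

Lemma char_fun_neq0 phi : exists x, char_fun phi x != 0.
Proof. by case: phi => f /= fP; case: (set_mem fP). Qed.

Lemma mk_character (f : G -> R) : (forall x y, f (x * y)%g = f x + f y) ->
  (exists x, f x != 0) -> exists phi, char_fun phi = f.
Proof.
move=> fM fN; have fc : f \in @nonzero_characters R G by apply/mem_set.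
by exists (exist _ f fc).
Qed.

Lemma character_continuous (T : topologicalType) (F : T -> character R G) :
  (forall x, continuous (fun z => char_fun (F z) x : R^o)) -> continuous F.
Proof.
move=> Fc; apply: continuous_comp_initial => z.
apply/cvg_sup => x; exact: continuous_comp_initial (Fc x) z.
Qed.

Lemma ray_continuous : continuous (@ray R G).
Proof. exact: pi_continuous. Qed.

Definition convex_pred P := forall f1 f2 (a b : R), P f1 -> P f2 ->
  0 <= a -> 0 <= b -> a + b = 1 -> P (fun x => a * f1 x + b * f2 x).

Lemma segment_in_convex P phi1 phi2 : convex_pred P ->
  (forall f, P f -> exists x, f x != 0) ->
  P (char_fun phi1) -> P (char_fun phi2) ->
  exists C : set (character_sphere R G), [/\ connected C, C (ray phi1), C (ray phi2) &
    C `<=` [set ray phi | phi in [set phi | P (char_fun phi)]]].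
Proof.
move=> Pc P0 P1 P2.
(* Clamping the parameter to the unit interval turns the segment into a path defined on the whole
   line, which is connected. *)
pose cl (a : R) : R := Num.min 1 (Num.max 0 a).
have cl0 a : 0 <= cl a by rewrite le_min ler01 le_max lexx.
have cl1 a : cl a <= 1 by rewrite ge_min lexx.
pose seg (a : R) x := (1 - cl a) * char_fun phi1 x + cl a * char_fun phi2 x.
have Pseg a : P (seg a) by apply: Pc => //; [rewrite subr_ge0|rewrite subrK].
have segM a x y : seg a (x * y)%g = seg a x + seg a y.
  by rewrite /seg !char_funM; ring.
have [F HF] := choice (fun a => mk_character (segM a) (P0 _ (Pseg a))).
have Fc : continuous F.
  apply: character_continuous => x.
  under eq_fun do rewrite HF.
  move=> a; have clc : {for a, continuous (cl : R^o -> R^o)}.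
    apply: continuous_min; first exact: cvg_cst.
    by apply: continuous_max; [exact: cvg_cst|exact: cvg_id].
  apply: cvgD; apply: cvgMl; last exact: clc.
  by apply: cvgB; [exact: cvg_cst|exact: clc].
have cl00 : cl 0 = 0 by rewrite /cl maxxx min_r.
have cl11 : cl 1 = 1 by rewrite /cl max_r// minxx.
have F_inj a phi : char_fun (F a) = char_fun phi -> ray (F a) = ray phi.
  by move=> e; congr ray; apply: val_inj.
exists [set ray (F a) | a in [set: R]]; split.
- rewrite (_ : [set _ | _ in _] = @ray R G @` (F @` setT)).
    apply: connected_continuous_connected; last first.
      exact/continuous_subspaceT/ray_continuous.
    apply: connected_continuous_connected; last exact/continuous_subspaceT/Fc.
    by apply/connected_intervalP.
  by rewrite image_comp.
- exists 0 => //; apply: F_inj; rewrite HF; apply/funext => x.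
  by rewrite /seg cl00 subr0 mul1r mul0r addr0.
- exists 1 => //; apply: F_inj; rewrite HF; apply/funext => x.
  by rewrite /seg cl11 subrr mul1r mul0r add0r.
- by move=> _ [a _ <-]; exists (F a) => //=; rewrite HF.
Qed.

Context (S : set G).

Let Sigma phi := full_subgraph_connected (cayley_adj S) [set h | 0 <= char_fun phi h].

Definition components_of (P : (G -> R) -> Prop) : set (set (character_sphere R G)) :=
  [set connected_component (BNS R S) (ray phi) |
     phi in [set phi | P (char_fun phi) /\ Sigma phi]].

(** Either no character in [P] lies in Sigma, or all do; then segments in [P] stay in Sigma and put
    all these rays in one component. *)
Lemma components_of_convex P : convex_pred P ->
  (forall f, P f -> exists x, f x != 0) ->
  (forall phi1 phi2, P (char_fun phi1) -> P (char_fun phi2) ->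
     Sigma phi1 -> Sigma phi2) ->
  finite_set (components_of P).
Proof.
move=> Pc P0 PS.
have [[phi0 [P1 S1]]|none] := pselect (exists phi, P (char_fun phi) /\ Sigma phi).
  apply: (sub_finite_set (B := [set connected_component (BNS R S) (ray phi0)])).
    move=> _ [phi [Pphi Sphi] <-] /=; apply: same_connected_component.
    have [C [Cc C1 C2 CP]] := segment_in_convex Pc P0 Pphi P1.
    exists C => //; split=> // z /CP[psi Ppsi <-]; exists psi => //.
    exact: PS P1 Ppsi S1.
  exact: finite_set1.
apply: (sub_finite_set (B := set0)) => // A [phi [P1 S1] _].
by apply: none; exists phi.
Qed.

Lemma components_of_cover (I : finType) (P : (G -> R) -> Prop)
    (Q : I -> (G -> R) -> Prop) :
  (forall phi, P (char_fun phi) -> exists i, Q i (char_fun phi)) ->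
  (forall i, finite_set (components_of (Q i))) ->
  finite_set (components_of P).
Proof.
move=> PQ Qfin.
apply: (sub_finite_set (B := \bigcup_(i in [set: I]) components_of (Q i))).
  move=> _ [phi [Pphi Sphi] <-]; have [i Qi] := PQ phi Pphi.
  by exists i => //; exists phi.
apply: bigcup_finite => // i _; exact: Qfin.
Qed.

End SphereComponents.

(** * The two-generator case *)

Section TwoGenerators.
Context (R : realType) (g : {multiplicative F2 -> F2}) (g_inj : injective g).
Context (S : set (hnn g)) (S_fin : finite_set S) (S_gen : generates S).
Local Notation G := (hnn g).
Local Notation emb := (@hnn_base F2 g).
Local Notation t := (hnn_stable g).
Local Notation gen := (@fgen 'I_2).
Local Open Scope classical_set_scope.
Local Open Scope ring_scope.

(** The four candidates for [c]; the complementary basis element is the generator of index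
    [rev_ord i]. *)
Let signed_gen (i : 'I_2) (b : bool) : F2 := if b then gen i else (gen i)^-1%g.

Let rev_ord_neq (i : 'I_2) : (i == rev_ord i) = false.
Proof. by case: i => -[|[|]]. Qed.

Let signed_gen_ind i b (H : F2 -> Prop) :
  (forall x y, H x -> H y -> H (x * y)%g) -> (forall x, H x -> H x^-1%g) ->
  H (signed_gen i b) -> H (gen (rev_ord i)) -> forall x, H x.
Proof.
move=> HM HV Hi Hj; apply: pres_class_ind => //.
  by rewrite -(mulVg (gen (rev_ord i))); apply: HM => //; exact: HV.
have {}Hi : H (gen i).
  by case: b Hi => //= /HV; rewrite invgK.
move=> k; have [->//|ki] := eqVneq k i.
suff -> : k = rev_ord i by [].
by apply/val_inj; case: i k ki {Hi Hj} => -[|[|]]// ? [[|[|]]].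
Qed.

Let fox_signed_gen i b f h :
  wsum [seq emb y | y <- fox (rev_ord i) (signed_gen i b)] f h = false.
Proof.
by case: b; rewrite /signed_gen ?wsum_foxV wsum_fox_gen rev_ord_neq.
Qed.

Let sigmaP phi : full_subgraph_connected (cayley_adj S) [set h | 0 <= char_fun phi h]
  <-> eventually_constant_criterion (char_fun (phi : character R G)).
Proof.
apply: connected_nonnegP => //; first exact: char_funM.
exact: char_fun_neq0.
Qed.

Let components_positive i b :
  finite_set (components_of S (fun f : G -> R => 0 < f (emb (signed_gen i b)))).
Proof.
pose c := signed_gen i b; pose j := rev_ord i.
apply: (components_of_cover (Q := fun J : {set 'I_(size (base g j c))} => piece J)).
  by move=> phi; apply: piece_cover; exact: char_funM.
move=> J; apply: components_of_convex.
- by move=> f1 f2 a a'; exact: piece_convex.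
- by move=> f [fc _ _]; exists (emb c); rewrite gt_eqF.
- move=> phi1 phi2 p1 p2 /sigmaP s1; apply/sigmaP; move: p1 p2 s1.
  by apply: piece_same => //; [exact: signed_gen_ind|exact: fox_signed_gen
    |exact: char_funM|exact: char_funM].
Qed.

Let vertical (b : bool) (f : G -> R) :=
  (forall x, f (emb x) = 0) /\ 0 < (if b then f t else - f t).

(** Characters trivial on the base are determined by their value at [t], so two of the same sign are
    positively proportional and have the same half-space. *)
Let vertical_nonneg b (phi1 phi2 : character R G) x :
  vertical b (char_fun phi1) -> vertical b (char_fun phi2) ->
  0 <= char_fun phi1 x -> 0 <= char_fun phi2 x.
Proof.
move=> [v1 t1] [v2 t2].
have : char_fun phi1 x * char_fun phi2 t = char_fun phi2 x * char_fun phi1 t.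
  elim/hnn_ind: x => [x y Hx Hy|x Hx|x|].
  - by rewrite !char_funM !mulrDl Hx Hy.
  - by rewrite !(characterV (char_funM _)) !mulNr Hx.
  - by rewrite v1 v2 !mul0r.
  - by rewrite mulrC.
move=> e x0; rewrite -(pmulr_lge0 _ t1); move: (mulr_ge0 x0 (ltW t2)).
by case: (b); rewrite ?mulrN e.
Qed.

Let components_vertical b : finite_set (components_of S (vertical b)).
Proof.
apply: components_of_convex.
- move=> f1 f2 a a' [v1 t1] [v2 t2] a0 a'0 aa'; split=> [x|].
    by rewrite v1 v2 !mulr0 addr0.
  rewrite (_ : (if b then _ else _) = a * (if b then f1 t else - f1 t) +
    a' * (if b then f2 t else - f2 t)); last by case: (b) => //; ring.
  have [a_gt0|a_le0] := ltP 0 a.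
    by rewrite ltr_pwDl ?mulr_gt0// mulr_ge0// ltW.
  by rewrite ltr_wpDl ?mulr_gt0//; [rewrite mulr_ge0// ltW|lra].
- move=> f [_]; case: b => ft; exists t; first by rewrite gt_eqF.
  by rewrite -oppr_eq0 gt_eqF.
move=> phi1 phi2 v1 v2; rewrite (_ : [set h | 0 <= char_fun phi2 h] =
  [set h | 0 <= char_fun phi1 h])//.
by apply/seteqP; split=> x; apply: vertical_nonneg; eassumption.
Qed.

Lemma finite_components_BNS : finite_set (connected_components (BNS R S)).
Proof.
have -> : connected_components (BNS R S) = components_of S (fun _ : G -> R => True).
  apply/seteqP; split=> [_ [_ [phi Sphi <-] <-]|_ [phi [_ Sphi] <-]].
    by exists phi.
  by exists (ray phi) => //; exists phi.
pose Q (k : 'I_2 * bool + bool) (f : G -> R) : Prop := match k with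
  | inl (i, b) => 0 < f (emb (signed_gen i b)) | inr b => vertical b f end.
apply: (components_of_cover (Q := Q)); last first.
  by case=> [[i b]|b]; [exact: components_positive|exact: components_vertical].
(* A character avoiding the four positive and the two vertical pieces vanishes on the base, then on
   [t], hence on [G]. *)
move=> phi _; apply: contrapT => /forallNP none.
have gen0 i : char_fun phi (emb (gen i)) = 0.
  apply/eqP; rewrite eq_le; apply/andP; split; rewrite leNgt; apply/negP => pos.
    exact: (none (inl (i, true))).
  apply: (none (inl (i, false))) => /=.
  by rewrite group_morphV (characterV (char_funM _)) oppr_gt0.
have emb0 x : char_fun phi (emb x) = 0.
  elim/(signed_gen_ind (i := ord0) (b := true)): x => [x y Hx Hy|x Hx||].
  - by rewrite gmulfM char_funM Hx Hy addr0.
  - by rewrite group_morphV (characterV (char_funM _)) Hx oppr0.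
  - exact: gen0.
  - exact: gen0.
have t0 : char_fun phi t = 0.
  apply/eqP; rewrite eq_le; apply/andP; split; rewrite leNgt; apply/negP => pos.
    exact: (none (inr true)).
  by apply: (none (inr false)); split; rewrite //= oppr_gt0.
have [x /eqP[]] := char_fun_neq0 phi.
elim/hnn_ind: x => // x.
  by move=> y Hx Hy; rewrite char_funM Hx Hy addr0.
by move=> Hx; rewrite (characterV (char_funM _)) Hx oppr0.
Qed.

End TwoGenerators.

Theorem corollary5p15 (R : realType) (g : {multiplicative F2 -> F2})
    (g_inj : injective g) (S : set (hnn g)) (S_fin : finite_set S)
    (S_gen : generates S) :
  finite_set (connected_components (BNS R S)).
Proof. exact: finite_components_BNS. Qed.
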